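(* Let $\lambda$ be a reflected skew shape. Let $$H(x,y)=\sum_{F\in\Gamma^{NF}(\lambda)}x^{|F|}y^{|\epsilon(F)|},\qquad H'(x,y)=\sum_{T\in\mathrm{SYT}(\lambda)}x^{\mathrm{des}(T)}y^{\mathrm{sdes}(T)},$$ where $\Gamma^{NF}(\lambda)$ is the nonfriendly complex of $\lambda$ and $\mathrm{SYT}(\lambda)$ is the set of standard Young tableaux of shape $\lambda$. Then $H(x,y)=H'(x,y)$.
   Context: A shape is a finite vertex-induced subgraph $\lambda$ of the square grid $\mathbb{Z}^2$. $(a,b)$ is immediately South of $(a,b+1)$ and immediately East of $(a-1,b)$; North and West are the reverse relations. A vertex of $\lambda$ is an interior vertex if all four of its neighbors in $\mathbb{Z}^2$ are in $\lambda$. The cell $\lambda_{(i,j)}$ at $(i,j)$ is the unit square with vertices $(i,j),(i+1,j),(i,j+1),(i+1,j+1)$; it is contained in $\lambda$ if these four points are vertices of $\lambda$. Its NW-corner is $(i,j+1)$ and its SE-corner is $(i+1,j)$. $\lambda$ is a reflected skew shape if: (1) whenever $(i,j)$ and $(i+1,j-1)$ are vertices of $\lambda$, so are $(i,j-1)$ and $(i+1,j)$; and (2) for any two cells $\lambda_{(a,b)},\lambda_{(c,d)}$ contained in $\lambda$ there are two sequences of cells contained in $\lambda$, $\lambda_{(a_0,b_0)},\ldots,\lambda_{(a_l,b_l)}$ and $\lambda_{(c_0,d_0)},\ldots,\lambda_{(c_l,d_l)}$, with $(a_0,b_0)=(c_0,d_0)$, $(a_l,b_l)=(c_l,d_l)$,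 $(a,b)=(a_i,b_i)$ and $(c,d)=(c_j,d_j)$ for some $i,j$, such that for each $k\in\{1,\dots,l\}$ the $k$-th cell in each sequence is immediately North or immediately East of the $(k-1)$-st cell of that sequence. A segment is a sequence of interior vertices $(v_0,\ldots,v_l)$, $l\ge0$, with each $v_i$ immediately South or East of $v_{i-1}$; it is lazy if it has only one vertex. If $u=(v_i,\dots,v_j)$ is a contiguous subsequence of a segment $s=(v_0,\dots,v_l)$, then $s$ starts with $u$ if $i=0$ and otherwise enters $u$ from the West (resp. North) if $v_{i-1}$ is immediately West (resp. North) of $v_i$; $s$ ends with $u$ if $j=l$ and otherwise leaves $u$ to the East (resp. South) if $v_{j+1}$ is immediately East (resp. South) of $v_j$. Two segments $s,t$ are friendly along a common subsegment $u$ if, up to exchanging $s$ and $t$: $s$ starts with $u$ or enters $u$ from the West, and $s$ ends with $u$ or leaves $u$ to the South; and $t$ starts with $u$ or enters $u$ from the North, and $t$ ends with $u$ or leaves $u$ to the East. They are nonfriendly if friendly along no segment. $\Gamma^{NF}(\lambda)$ is the simplicial complex of sets of segments (including $\emptyset$) whose distinct members are pairwise nonfriendly. For a set $S$ of segments, $\epsilon(S)$ is the set of lazy segments in $S$ not contained in any other member of $S$. Let $Q_\lambda$ be the poset of cells contained in $\lambda$ with $\lambda_{(a,b)}\le\lambda_{(c,d)}$ iff $a\le c$ and $b\le d$, and let $N$ be the number of cells. A standard Young tableau of shape $\lambda$ is a linear extension of $Q_\lambda$, viewed as a bijective filling of the cells by $1,\dots,N$ with labels increasing to the East and North. An integer $i\in\{1,\dots,N-1\}$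 is a descent of $T$ if the cell $\lambda_{i+1}$ containing $i+1$ is strictly Northwest (strictly North and strictly West) of the cell $\lambda_i$ containing $i$. To such a descent one associates the unique segment on the boundary of the union of the cells with labels at most $i+1$ whose endpoints are the SE-corner of $\lambda_{i+1}$ and the NW-corner of $\lambda_i$. $\mathrm{Des}(T)$ is the set of segments associated to descents of $T$. A descent is simple if its segment is lazy and not properly contained in any other segment of $\mathrm{Des}(T)$; $\mathrm{SDes}(T)$ is the set of segments of simple descents. $\mathrm{des}(T)=|\mathrm{Des}(T)|$ and $\mathrm{sdes}(T)=|\mathrm{SDes}(T)|$.
   Formalization: A vertex is taken to be interior when the four cells around it are contained in λ, not merely its four neighbors; with the neighbor condition the claim fails, e.g. for the cells (0,0), (0,1), (1,1), where H = 1 + xy but H' = 1. *)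

(* Defs.v *)
From HB Require Import structures.
From mathcomp Require Import all_boot all_order all_algebra.
From mathcomp Require Import finmap.

Set Implicit Arguments.
Unset Strict Implicit.
Unset Printing Implicit Defensive.

Import Order.TTheory GRing.Theory Num.Theory.

Local Open Scope ring_scope.

Notation point := (int * int)%type.

Definition east  (v : point) : point := (v.1 + 1, v.2).
Definition west  (v : point) : point := (v.1 - 1, v.2).
Definition north (v : point) : point := (v.1, v.2 + 1).
Definition south (v : point) : point := (v.1, v.2 - 1).

(* An induced subgraph of the grid is determined by its vertex set. *)
Notation grid_shape := {fset point}.

(* Cells are named by their SW-corners. *)
Definition has_cell (lam : grid_shape) (c : point) : bool :=
  [&& c \in lam, east c \in lam, north c \in lam & north (east c) \in lam].

Definition cells (lam : grid_shape) : {fset point} :=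
  [fset c in lam | has_cell lam c]%fset.

Definition NW_corner (c : point) : point := north c.
Definition SE_corner (c : point) : point := east c.

(* The four unit squares of the grid that have v as a corner. *)
Definition cells_at (v : point) : seq point :=
  [:: v; west v; south v; west (south v)].

(* A vertex is interior when lam surrounds it, i.e. contains the four cells
   around it; this implies that the four neighbours of v are in lam.  Asking
   only for the four neighbours would be too weak at the reflex corners of a
   non-rectangular shape: for the three cells (0,0), (0,1), (1,1) the vertex
   (1,1) has its four neighbours in lam but lies on the boundary of the region.
   It would give a one-vertex segment, hence two faces of the complex, whereas
   there is only one standard tableau. *)
Definition interior (lam : grid_shape) (v : point) : bool :=
  all (has_cell lam) (cells_at v).

Definition cell_step (c d : point) : bool := (d == north c) || (d == east c).

Definition cell_chain (lam : grid_shape) (c0 : point) (p : seq point) : bool :=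
  all (has_cell lam) (c0 :: p) && path cell_step c0 p.

Definition reflected_skew_shape (lam : grid_shape) : Prop :=
  (forall v : point, v \in lam -> south (east v) \in lam ->
     (south v \in lam) && (east v \in lam)) /\
  (forall c d : point, has_cell lam c -> has_cell lam d ->
     exists (o : point) (p q : seq point),
       [/\ cell_chain lam o p && cell_chain lam o q,
           size p = size q,
           last o p = last o q,
           c \in o :: p
         & d \in o :: q]).

Definition seg_step (v w : point) : bool := (w == south v) || (w == east v).

Definition is_segment (lam : grid_shape) (s : seq point) : bool :=
  [&& s != [::], all (interior lam) s & sorted seg_step s].

Record segment (lam : grid_shape) := Segment {
  vertices :> seq point;
  segmentP : is_segment lam vertices
}.

HB.instance Definition _ lam := [isSub for @vertices lam].
HB.instance Definition _ lam := [Countable of segment lam by <:].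

(* A segment visits each vertex at most once, so there are finitely many. *)
Section SegmentFinite.
Variable lam : grid_shape.

Lemma sorted_seg_step_uniq s : sorted seg_step s -> uniq s.
Proof.
pose e (v w : point) := (v.1 - v.2 < w.1 - w.2)%R.
have etr : transitive e by move=> ? ? ?; apply: lt_trans.
have eirr : irreflexive e by move=> ?; apply: ltxx.
move=> ss; apply: (sorted_uniq etr eirr); apply: sub_sorted ss => v w.
by rewrite /e => /orP[] /eqP-> /=; rewrite ?opprB ?addrA -?addrA ltrD2l;
  rewrite ?ltrDr ?addrC ?ltrDl.
Qed.

Lemma size_segment (s : segment lam) : (size s <= #|` lam|)%N.
Proof.
case: s => s /= /and3P[_ /allP si /sorted_seg_step_uniq us].
apply: uniq_leq_size => // v /si /andP[/and4P[]] //.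
Qed.

Fixpoint bounded_seqs n : seq (seq point) :=
  if n is m.+1 then [::] :: [seq v :: s | v <- enum_fset lam, s <- bounded_seqs m]
  else [:: [::]].

Lemma mem_bounded_seqs n s :
  (size s <= n)%N -> {subset s <= lam} -> s \in bounded_seqs n.
Proof.
elim: n s => [|n IHn] [|v s] //= sn sl; rewrite inE /=.
apply/allpairsP; exists (v, s); split=> //=; first by apply: sl; rewrite mem_head.
by apply: IHn => // w ws; apply: sl; rewrite inE ws orbT.
Qed.

Definition segment_enum : seq (segment lam) :=
  undup (pmap insub (bounded_seqs #|` lam|)).

Lemma segment_enumP : Finite.axiom segment_enum.
Proof.
move=> s; rewrite count_uniq_mem ?undup_uniq // mem_undup mem_pmap_sub.
rewrite mem_bounded_seqs ?size_segment // => v.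
by have /and3P[_ /allP si _] := segmentP s; move/si => /andP[/and4P[]].
Qed.

End SegmentFinite.

HB.instance Definition _ lam := isFinite.Build (segment lam) (@segment_enumP lam).

Definition lazy_seg (s : seq point) : bool := size s == 1%N.

(* (s_i, ..., s_j) *)
Definition subseg (s : seq point) (i j : nat) : seq point :=
  take (j.+1 - i) (drop i s).

(* s starts with its subsegment beginning at index i, or enters it from the
   direction dir. *)
Definition starts_or_enters (dir : point -> point) (s : seq point) (i : nat) :=
  (i == 0%N) || (nth (0, 0) s i.-1 == dir (nth (0, 0) s i)).

(* s ends with its subsegment finishing at index j, or leaves it to the
   direction dir. *)
Definition ends_or_leaves (dir : point -> point) (s : seq point) (j : nat) :=
  (j.+1 == size s) || (nth (0, 0) s j.+1 == dir (nth (0, 0) s j)).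

(* The common subsegment is (s_i, ..., s_j) = (t_k, ..., t_l). *)
Definition friendly_oriented (s t : seq point) : bool :=
  [exists i : 'I_(size s), [exists j : 'I_(size s),
   [exists k : 'I_(size t), [exists l : 'I_(size t),
    [&& (i <= j)%N, (k <= l)%N, subseg s i j == subseg t k l,
        starts_or_enters west s i, ends_or_leaves south s j,
        starts_or_enters north t k & ends_or_leaves east t l]]]]].

Definition friendly (s t : seq point) : bool :=
  friendly_oriented s t || friendly_oriented t s.

Definition nonfriendly_complex (lam : grid_shape) : {set {set segment lam}} :=
  [set F : {set segment lam} |
    [forall s in F, forall t in F, (s != t) ==> ~~ friendly s t]].

(* On segments, [infix] is containment as a contiguous subsequence. *)
Definition eps (lam : grid_shape) (S : {set segment lam}) : {set segment lam} :=
  [set s in S | lazy_seg s & [forall t in S, (t != s) ==> ~~ infix s t]].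

Definition cell_le (c d : point) : bool := (c.1 <= d.1) && (c.2 <= d.2).

(* Labels are 0-based: the label of the cell c in the tableau T is (T c).+1.
   Being injective between finite types of the same cardinal, T is bijective. *)
Definition SYT (lam : grid_shape) : {set {ffun cells lam -> 'I_#|` cells lam|}} :=
  [set T : {ffun cells lam -> 'I_#|` cells lam|} | injectiveb T &
    [forall c, forall d, cell_le (val c) (val d) ==> (T c <= T d)%N]].

Definition strictly_NW (d c : point) : bool := (d.1 < c.1) && (c.2 < d.2).

(* U is a set of cells; the next three predicates say that a vertex, a unit
   edge from v to w (w being south or east of v) and a segment lie on the
   boundary of the union of the cells of U. *)
Definition boundary_vertex (U : pred point) (v : point) : bool :=
  has U (cells_at v) && ~~ all U (cells_at v).

Definition boundary_edge (U : pred point) (v w : point) : bool :=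
  if w == east v then U v != U (south v) else U w != U (west w).

Definition on_boundary (U : pred point) (s : seq point) : bool :=
  all (boundary_vertex U) s && sorted (boundary_edge U) s.

Section Descents.
Variables (lam : grid_shape) (T : {ffun cells lam -> 'I_#|` cells lam|}).

(* c contains some label i, and d contains i + 1. *)
Definition descent (c d : cells lam) : bool :=
  (T d == (T c).+1 :> nat) && strictly_NW (val d) (val c).

(* The cells whose labels are at most that of d. *)
Definition filled_upto (d : cells lam) : pred point :=
  fun e => [exists e' : cells lam, (val e' == e) && (T e' <= T d)%N].

Definition descent_segment (c d : cells lam) (s : segment lam) : bool :=
  [&& head (0, 0) s == SE_corner (val d),
      last (0, 0) s == NW_corner (val c)
    & on_boundary (filled_upto d) s].

Definition Des : {set segment lam} :=
  [set s | [exists c, exists d, descent c d && descent_segment c d s]].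

Definition SDes : {set segment lam} :=
  [set s in Des | lazy_seg s & [forall t in Des, ~~ (infix s t && (s != t))]].

Definition des : nat := #|Des|.
Definition sdes : nat := #|SDes|.

End Descents.

(* Polynomials in two variables x and y with integer coefficients. *)
Definition poly_x : {poly {poly int}} := 'X.
Definition poly_y : {poly {poly int}} := 'X%:P.

Definition H_poly (lam : grid_shape) : {poly {poly int}} :=
  \sum_(F in nonfriendly_complex lam) poly_x ^+ #|F| * poly_y ^+ #|eps F|.

Definition H'_poly (lam : grid_shape) : {poly {poly int}} :=
  \sum_(T in SYT lam) poly_x ^+ des T * poly_y ^+ sdes T.

(* Main.v *)
Require Import Defs.
From mathcomp Require Import all_boot all_order all_algebra.
From mathcomp Require Import finmap zify.

(* The descent sets of the standard tableaux are not the faces of the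
   nonfriendly complex, but those of another complex on the same segments, in
   which two segments must not cross, where the nonfriendly complex forbids
   them to touch without crossing.  Both complexes are parametrized by the
   same flows.  A family records at each vertex how many of its segments start,
   end, and come from the west or from the north.  When the segments through a
   vertex are sorted by the way they diverge afterwards, compatibility says that
   this order refines the order of the entry directions, west < start < north,
   so the family is recovered from the flow by following the segments backwards
   from their ends.  Since the two complexes differ only in the order in which
   exits are compared, exchanging this order is a bijection, and it preserves
   the number of segments as well as the isolated lazy ones.

   On the tableau side, a tableau is a linear order on the cells, and its
   inversions with respect to the column-by-column order are generated
   transitively by its descent segments.  Conversely, the inversions generated
   by a family of segments always define a linear order (a join in the weak
   order), and when no two segments cross the given segments are exactly its
   descents. *)

Set Implicit Arguments.
Unset Strict Implicit.
Unset Printing Implicit Defensive.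

Import Order.TTheory GRing.Theory Num.Theory.

Local Open Scope ring_scope.

(** * Segments that touch or cross *)

(** Starting counts as entering from either direction, and ending as leaving in either direction.
    Therefore two members of a compatible family never share a start or an end, in both complexes,
    and a vertex sees at most one start and one end; this is what makes the sorted assignment of
    entries compatible. The backward reconstruction is an induction on [lev], which every step of a
    segment raises by one. For the tableaux the obstacle is that a transitively closed set of
    inversions need not come from a linear order: its complement must be transitive too. This holds
    because every segment separates all the cells that lie, column by column, between its two end
    cells ([sides_cover]). Compatibility then keeps the end cells of each segment adjacent in the
    resulting order, so that they form a descent. The shape enters through [has_cell_rectangle]: the
    rectangle spanned by the two cells of a descent is filled, so the vertices of the boundary path
    between them are interior. *)

Notation origin := ((0, 0) : point).
Notation hd s := (head origin s).

(** Each segment step raises it by one, so the position of a vertex on a segment can be read off its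
    level and that of the head. *)
Definition lev (v : point) : int := v.1 - v.2.

Lemma point_eqE (v w : point) : (v == w) = (v.1 == w.1) && (v.2 == w.2).
Proof. by case: v w => [a b] [c d]; rewrite xpair_eqE. Qed.

Lemma westE v : v = west (east v).
Proof. by case: v => a b; congr pair => /=; lia. Qed.
Lemma northE v : v = north (south v).
Proof. by case: v => a b; congr pair => /=; lia. Qed.

Lemma seg_stepE v w : seg_step v w = (v == west w) || (v == north w).
Proof. by rewrite /seg_step !point_eqE /=; apply/idP/idP; lia. Qed.

Lemma west_neq_north v : (west v == north v) = false.
Proof. by rewrite point_eqE /=; lia. Qed.

Lemma lev_step v w : seg_step v w -> lev w = lev v + 1.
Proof. by rewrite /seg_step !point_eqE /lev /=; lia. Qed.

Lemma lev_path v p (i : nat) : path seg_step v p -> (i <= size p)%N ->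
  lev (nth origin (v :: p) i) = lev v + i%:Z.
Proof.
elim: p v i => [|w p IHp] v [|i] //=; rewrite ?addr0 //.
move=> /andP[vw wp] ilt; rewrite -/(nth origin (w :: p) i) IHp //.
by rewrite (lev_step vw) -addrA; congr (_ + _); lia.
Qed.

(* The two complexes that are compared differ only in the direction in which
   the lower of two touching segments may leave; [false] is the friendly case. *)
Definition lo (b : bool) : point -> point := if b then south else east.
Definition hi (b : bool) : point -> point := if b then east else south.

Lemma lo_neq_hi b v : (lo b v == hi b v) = false.
Proof. by case: b; rewrite point_eqE /=; lia. Qed.

Lemma seg_step_lohi b v w : seg_step v w = (w == lo b v) || (w == hi b v).
Proof. by case: b; rewrite // orbC. Qed.

(** [clash false] is convertible to [friendly_oriented]. In [clash true] the segment from the west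
    leaves to the east and the one from the north leaves to the south, so they cross. *)
Definition clash (b : bool) (s t : seq point) : bool :=
  [exists i : 'I_(size s), [exists j : 'I_(size s),
   [exists k : 'I_(size t), [exists l : 'I_(size t),
    [&& (i <= j)%N, (k <= l)%N, subseg s i j == subseg t k l,
        starts_or_enters west s i, ends_or_leaves (hi b) s j,
        starts_or_enters north t k & ends_or_leaves (lo b) t l]]]]].

Definition enters (d : point -> point) (s1 u : seq point) :=
  (s1 == [::]) || (last origin s1 == d (hd u)).
Definition leaves (d : point -> point) (u s2 : seq point) :=
  (s2 == [::]) || (hd s2 == d (last origin u)).

Lemma starts_or_enters_cat d s1 u s2 : u != [::] ->
  starts_or_enters d (s1 ++ u ++ s2) (size s1) = enters d s1 u.
Proof.
case: u => // v u _; rewrite /starts_or_enters /enters -size_eq0.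
have -> : nth origin (s1 ++ (v :: u) ++ s2) (size s1) = v.
  by rewrite nth_cat ltnn subnn.
case/lastP: s1 => [//|s1 w]; rewrite size_rcons /= last_rcons cat_rcons.
by rewrite nth_cat ltnn subnn.
Qed.

Lemma ends_or_leaves_cat d s1 u s2 : u != [::] ->
  ends_or_leaves d (s1 ++ u ++ s2) (size s1 + (size u).-1)%N = leaves d u s2.
Proof.
case/lastP: u => // u w _; rewrite /ends_or_leaves /leaves size_rcons /=.
rewrite !size_cat size_rcons last_rcons -addnS nth_cat.
rewrite ltnNge leq_addr /= addKn nth_cat size_rcons ltnn subnn.
rewrite [nth _ _ (size s1 + size u)%N]nth_cat ltnNge leq_addr /= addKn.
rewrite nth_cat size_rcons ltnSn nth_rcons ltnn eqxx.
rewrite addnA -[X in X == _]addn0 eqn_add2l.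
by case: s2 => [|x s2] //=; rewrite eq_refl.
Qed.

Lemma subseg_cat s1 u s2 : u != [::] ->
  subseg (s1 ++ u ++ s2) (size s1) (size s1 + (size u).-1)%N = u.
Proof.
move=> u0; rewrite /subseg drop_size_cat // subSn ?leq_addr // addKn.
by rewrite prednK ?lt0n ?size_eq0 // take_size_cat.
Qed.

Lemma subseg_split s i j : (i <= j)%N -> (j < size s)%N ->
  exists s1 u s2, [/\ s = s1 ++ u ++ s2, u != [::], i = size s1,
    j = (size s1 + (size u).-1)%N & u = subseg s i j].
Proof.
move=> ij js.
have su : size (subseg s i j) = (j.+1 - i)%N.
  by rewrite /subseg size_takel // size_drop leq_sub2r.
exists (take i s), (subseg s i j), (drop (j.+1 - i) (drop i s)).
have si : size (take i s) = i by rewrite size_takel // ltnW // (leq_ltn_trans ij).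
by split; rewrite ?cat_take_drop // ?si // -?size_eq0 su subSn // subnKC.
Qed.

(** Trades the four indices for concatenations around the common stretch [u]. *)
Lemma clashP b s t : reflect (exists s1 s2 t1 t2 u,
  [/\ s = s1 ++ u ++ s2, t = t1 ++ u ++ t2, u != [::],
      enters west s1 u && leaves (hi b) u s2 &
      enters north t1 u && leaves (lo b) u t2]) (clash b s t).
Proof.
apply: (iffP idP) => [/'exists_'exists_'exists_existsP[i [j [k [l]]]]|].
  move=> /and4P[ij kl /eqP st /and4P[h1 h2 h3 h4]].
  have [s1 [u [s2 [es u0 ei ej eu]]]] := subseg_split ij (ltn_ord j).
  have [t1 [u' [t2 [et u0' ek el eu']]]] := subseg_split kl (ltn_ord l).
  have uu : u' = u by rewrite eu eu' st.
  rewrite {}uu in et el.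
  exists s1, s2, t1, t2, u; split=> //.
    by move: h1 h2; rewrite ei ej es starts_or_enters_cat // ends_or_leaves_cat // => -> ->.
  by move: h3 h4; rewrite ek el et starts_or_enters_cat // ends_or_leaves_cat // => -> ->.
move=> [s1 [s2 [t1 [t2 [u [es et u0 /andP[h1 h2] /andP[h3 h4]]]]]]].
have u1 : (0 < size u)%N by rewrite lt0n size_eq0.
have Hi (r1 r2 : seq point) : (size r1 < size (r1 ++ u ++ r2))%N.
  by rewrite !size_cat -[X in (X < _)%N]addn0 ltn_add2l ltn_addr.
have Hj (r1 r2 : seq point) :
    (size r1 + (size u).-1 < size (r1 ++ u ++ r2))%N.
  by rewrite !size_cat ltn_add2l ltn_addr // ltn_predL.
subst s t; apply/existsP; exists (Ordinal (Hi s1 s2)).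
apply/existsP; exists (Ordinal (Hj s1 s2)).
apply/existsP; exists (Ordinal (Hi t1 t2)).
apply/existsP; exists (Ordinal (Hj t1 t2)).
rewrite /= !subseg_cat // !starts_or_enters_cat // !ends_or_leaves_cat //.
by rewrite h1 h2 h3 h4 eqxx !leq_addr.
Qed.

(* The order in which two paths out of v diverge: leaving low comes before
   ending, which comes before leaving high. *)
Fixpoint below (b : bool) (v : point) (p q : seq point) : bool :=
  match p, q with
  | [::], [::] => false
  | [::], w :: _ => w == hi b v
  | w :: _, [::] => w == lo b v
  | w :: p', z :: q' => if w == z then below b w p' q' else w == lo b v
  end.

Lemma below_irr b v p : below b v p p = false.
Proof. by elim: p v => //= w p IHp v; rewrite eqxx. Qed.

Lemma below_total b v p q : path seg_step v p -> path seg_step v q -> p != q ->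
  below b v p q || below b v q p.
Proof.
elim: p v q => [|w p IHp] v [|z q] //=; rewrite ?(seg_step_lohi b).
- by move=> _ /andP[+ _] _; rewrite orbC.
- by move=> /andP[].
move=> /andP[vw wp] /andP[vz zq]; rewrite eqseq_cons [z == w]eq_sym.
case: (w =P z) zq => [<- zq /= |wz _ _]; first exact: IHp.
by case/orP: vw vz wz => /eqP-> /orP[]/eqP-> //; rewrite ?eqxx ?orbT.
Qed.

Lemma below_trans b v p q r : path seg_step v p -> path seg_step v q ->
  path seg_step v r -> below b v p q -> below b v q r -> below b v p r.
Proof.
have hl := lo_neq_hi b v; have lh : (hi b v == lo b v) = false by rewrite eq_sym.
elim: p v q r hl lh => [|w p IHp] v [|z q] [|x r] //= hl lh.
- by move=> _ /andP[_ _] _ /eqP->; rewrite lh.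
- move=> _ /andP[vz zq] /andP[vx xr] /eqP ez; subst z.
  by case: eqP => [<-//|_]; rewrite lh.
- move=> /andP[vw wp] _ /andP[vx xr] /eqP-> /eqP->; by rewrite hl eqxx.
- move=> /andP[vw wp] /andP[vz zq] _; case: (w =P z) => [-> //|wz /eqP-> //].
move=> /andP[vw wp] /andP[vz zq] /andP[vx xr].
case: (w =P z) zq => [<- zq|wz zq /eqP ew].
  case: (w =P x) xr => // <- xr; apply: (IHp w q r) => //.
    exact: lo_neq_hi.
  by rewrite eq_sym lo_neq_hi.
case: (z =P x) => [<- _|zx /eqP ez]; first by case: eqP wz => // _ _; rewrite ew.
by case: wz; rewrite ew ez.
Qed.

Lemma below_split b v p q : path seg_step v p -> path seg_step v q ->
  below b v p q -> exists u p2 q2, [/\ v :: p = (v :: u) ++ p2,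
    v :: q = (v :: u) ++ q2, leaves (lo b) (v :: u) p2 & leaves (hi b) (v :: u) q2].
Proof.
elim: p v q => [|w p IHp] v [|z q] //=.
- by move=> _ _ /eqP zv; exists [::], [::], (z :: q); rewrite /leaves /= zv eqxx.
- by move=> _ _ /eqP wv; exists [::], (w :: p), [::]; rewrite /leaves /= wv eqxx.
move=> /andP[vw wp] /andP[vz zq]; case: (w =P z) zq => [<- zq h|wz _ /eqP ew].
  have [u [p2 [q2 [ep eq l1 l2]]]] := IHp _ _ wp zq h.
  by exists (w :: u), p2, q2; rewrite /= ep eq.
exists [::], (w :: p), (z :: q); rewrite /leaves /= ew eqxx; split=> //.
by move: vz wz; rewrite (seg_step_lohi b) ew => /orP[]/eqP-> //; rewrite ?eqxx.
Qed.

(** The exception is that both paths stop with [u], since stopping counts as leaving low and as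
    leaving high. *)
Lemma split_below b v u p2 q2 : leaves (lo b) (v :: u) p2 ->
  leaves (hi b) (v :: u) q2 -> below b v (u ++ p2) (u ++ q2) || ((p2 == [::]) && (q2 == [::])).
Proof.
elim: u v => [|w u IHu] v /=; last by rewrite eqxx; apply: IHu.
rewrite /leaves; case: p2 q2 => [|w p2] [|z q2] //=; rewrite ?orbF //.
by move=> /eqP-> /eqP->; rewrite lo_neq_hi eqxx.
Qed.

Lemma max_common_suffix (s t : seq point) : exists s1 t1 u : seq point,
  [/\ s = s1 ++ u, t = t1 ++ u &
      [|| s1 == [::], t1 == [::] | last origin s1 != last origin t1]].
Proof.
elim/last_ind: s t => [|s a IHs] t.
  by exists [::], t, [::]; rewrite !cats0.
case/lastP: t => [|t c]; first by exists (rcons s a), [::], [::]; rewrite !cats0 /= orbT.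
case: (eqVneq a c) => [<-|ac].
  have [s1 [t1 [u [-> -> h]]]] := IHs t.
  by exists s1, t1, (rcons u a); rewrite !rcons_cat.
by exists (rcons s a), (rcons t c), [::]; rewrite !cats0 !last_rcons ac !orbT.
Qed.

(** * Compatible families and their tails *)

Section Complex.
Variable lam : grid_shape.
Notation seg := (segment lam).
Implicit Types (F G A : {set seg}) (p q s t : seg) (v w : point) (b : bool).

Lemma seg_cons p : vertices p = hd p :: behead p.
Proof. by case: p => -[|v s]. Qed.

Lemma seg_path p : path seg_step (hd p) (behead p).
Proof. by case: p => -[|v s] //= /and3P[]. Qed.

Lemma lev_last p : lev (last origin p) = lev (hd p) + (size p).-1%:Z.
Proof.
have := seg_path p; rewrite -nth_last; case: p => -[|v s] //= _ sp.
by rewrite -(lev_path sp (leqnn _)).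
Qed.

Lemma seg_interior p v : v \in vertices p -> interior lam v.
Proof. by case: p => s /= /and3P[_ /allP h _] /h. Qed.

Lemma last_interior p : interior lam (last origin p).
Proof.
by apply: (@seg_interior p); case: p => -[|v s] //= _; apply: mem_last.
Qed.

Lemma hd_interior p : interior lam (hd p).
Proof. by apply: (@seg_interior p); rewrite seg_cons mem_head. Qed.

Lemma is_segment_cons v (p : seq point) : is_segment lam (v :: p) =
  (interior lam v && ((p == [::]) || (seg_step v (hd p) && is_segment lam p))).
Proof.
case: p => [|w p]; rewrite /is_segment [all _ _]/= ?andbT //= -!andbA.
by rewrite !(andbCA _ (seg_step v w)).
Qed.

Lemma is_segment_catr (s1 p : seq point) : p != [::] -> is_segment lam (s1 ++ p) -> is_segment lam p.
Proof.
move=> p0 /and3P[_]; rewrite all_cat /is_segment p0 => /andP[_ ->] /=.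
by case: s1 => //= v s1; rewrite cat_path => /andP[_]; case: p p0 => //= w p _ /andP[].
Qed.

Definition compatible_family b : {set {set seg}} :=
  [set F : {set seg} | [forall s in F, forall t in F,
     (s != t) ==> ~~ (clash b s t || clash b t s)]].

Lemma compatible_familyP b F :
  reflect (forall s t, s \in F -> t \in F -> s != t -> ~~ clash b s t)
          (F \in compatible_family b).
Proof.
rewrite inE; apply: (iffP 'forall_in_forall_inP) => h.
  by move=> s t sF tF st; move/implyP/(_ st): (h s sF t tF); rewrite negb_or => /andP[].
by move=> s sF t tF; apply/implyP=> st; rewrite negb_or !h // eq_sym.
Qed.

(** A tail with head [v] stands for one passage of the family through [v]. The lock keeps [inE] from
    unfolding membership. *)
Definition tails F : {set seg} := locked [set p : seg | [exists s in F, suffix p s]].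

Lemma tailsP F p :
  reflect (exists2 s, s \in F & exists s1 : seq point, vertices s = s1 ++ p) (p \in tails F).
Proof.
rewrite /tails -lock inE; apply: (iffP 'exists_in_idP) => -[s sF]; last first.
  by move=> [s1 es]; exists s => //; apply/suffixP; exists s1.
by case/suffixP=> s1 es; exists s => //; exists s1.
Qed.

Lemma sub_tails F p : p \in F -> p \in tails F.
Proof. by move=> pF; apply/tailsP; exists p => //; exists [::]. Qed.

Lemma tails_cons F p q v : q \in tails F -> vertices q = v :: p -> p \in tails F.
Proof.
move=> /tailsP[s sF [s1 es]] eq; apply/tailsP; exists s => //.
by exists (rcons s1 v); rewrite cat_rcons es eq.
Qed.

Lemma last_cat_seg (s1 : seq point) p : last origin (s1 ++ p) = last origin p.
Proof. by rewrite last_cat seg_cons. Qed.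

Section Compatible.
Variables (b : bool) (F : {set seg}).
Hypothesis Fb : F \in compatible_family b.

(** Compatibility as an order statement: otherwise the stretch shared by [p] and [q] would be a
    clash of [t] with [s]. *)
Lemma below_entry s t (s1 t1 : seq point) p q : s \in F -> t \in F ->
  vertices s = s1 ++ p -> vertices t = t1 ++ q -> hd p = hd q ->
  below b (hd p) (behead p) (behead q) ->
  enters north s1 p -> enters west t1 q -> False.
Proof.
move=> sF tF es et pq pbq e1 e2.
have [/eqP st|st] := boolP (t == s).
  (* Tails of one segment with the same head have the same length, since [lev] counts the steps to
     the common last vertex. *)
  have pqe : vertices p = vertices q.
    have: suffix p s && suffix q s.
      by rewrite es suffix_suffix -es -st et suffix_suffix.
    case/andP; rewrite es => _ /suffixP[r er].
    have lp := lev_last p; have lq := lev_last q.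
    have ll : last origin p = last origin q.
      by rewrite -(last_cat_seg s1 p) er last_cat_seg.
    have sz : size (vertices p) = size (vertices q).
      by move: lp lq; rewrite ll pq => -> /addrI [];
        rewrite [in size p](seg_cons p) [in size q](seg_cons q) /= => ->.
    have sr : size s1 = size r.
      by have := congr1 size er; rewrite !size_cat sz => /eqP; rewrite eqn_add2r => /eqP.
    by move/eqP: er; rewrite eqseq_cat // => /andP[_ /eqP].
  by move: pbq; rewrite pqe below_irr.
have pq2 := seg_path q; rewrite -pq in pq2.
have [u [p2 [q2 [ep eq l1 l2]]]] := below_split (seg_path p) pq2 pbq.
have := compatible_familyP _ _ Fb t s tF sF st; move/negP; apply.
rewrite -seg_cons in ep; rewrite pq -seg_cons -pq in eq.
apply/clashP; exists t1, q2, s1, p2, (hd p :: u); split=> //.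
- by rewrite et eq.
- by rewrite es ep.
- by move: e2 l2; rewrite /enters /= pq => ->.
- by move: e1 l1; rewrite /enters /= => ->.
Qed.

(** One of two distinct paths out of a vertex is below the other, and a start satisfies both entry
    conditions of [below_entry]. *)
Lemma starts_uniq s t : s \in F -> t \in F -> hd s = hd t -> s = t.
Proof.
move=> sF tF st; apply/eqP/negPn/negP => nst.
have tp := seg_path t; rewrite -st in tp.
have nb : behead s != behead t.
  by apply: contraNneq nst => e; rewrite -val_eqE /= (seg_cons s) (seg_cons t) st e.
case/orP: (below_total b (seg_path s) tp nb) => h.
  by apply: (@below_entry s t [::] [::] s t).
by apply: (@below_entry t s [::] [::] t s); rewrite // -st.
Qed.

(** On the longest common suffix both exit conditions hold, so only the entries matter. They differ
    there, hence one can be read as western and the other as northern. *)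
Lemma ends_uniq s t : s \in F -> t \in F -> last origin s = last origin t -> s = t.
Proof.
move=> sF tF st; apply/eqP/negPn/negP => nst.
have [s1 [t1 [u [es et h]]]] := max_common_suffix s t.
have u0 : u != [::].
  apply: contraNneq (nst) => u0; move: es et h st; rewrite u0 !cats0 => <- <-.
  by rewrite (seg_cons s) (seg_cons t) /= => + E; rewrite E eqxx.
have ent (r : seg) (r1 : seq point) : vertices r = r1 ++ u -> r1 != [::] ->
    enters west r1 u || enters north r1 u.
  case: r => r /= /and3P[_ _ +] er; rewrite {r}er.
  case/lastP: r1 => // r1 w + _; rewrite cat_rcons /enters last_rcons.
  case: u u0 {es et h} => // z u _; rewrite sorted_cat_cons /= => /andP[_ /andP[+ _]].
  by rewrite seg_stepE => /orP[]->; rewrite ?orbT.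
have H (r r' : seg) (r1 r1' : seq point) : r \in F -> r' \in F -> r != r' ->
   vertices r = r1 ++ u -> vertices r' = r1' ++ u ->
   enters west r1 u -> enters north r1' u -> False.
  move=> rF rF' rr er er' e e'.
  have := compatible_familyP _ _ Fb r r' rF rF' rr; move/negP; apply.
  apply/clashP; exists r1, [::], r1', [::], u; rewrite !cats0 e e'.
  by split.
have nts : t != s by rewrite eq_sym.
case: (eqVneq s1 [::]) => [e1|n1].
  have hs d : enters d s1 u by rewrite /enters e1.
  case: (eqVneq t1 [::]) => [e2|n2].
    by move: nst; rewrite -val_eqE /= es et e1 e2 eqxx.
  case/orP: (ent _ _ et n2) => E; first exact: (H t s t1 s1).
  exact: (H s t s1 t1).
case: (eqVneq t1 [::]) => [e2|n2].
  have ht d : enters d t1 u by rewrite /enters e2.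
  case/orP: (ent _ _ es n1) => E; first exact: (H s t s1 t1).
  exact: (H t s t1 s1).
move: h (ent _ _ es n1) (ent _ _ et n2).
rewrite (negPf n1) (negPf n2) /enters (negPf n1) (negPf n2) /= => h.
have H1 := H s t _ _ sF tF nst es et; have H2 := H t s _ _ tF sF nts et es.
rewrite /enters (negPf n1) (negPf n2) /= in H1 H2.
case/orP=> [Es|Es]; case/orP=> Et.
- by rewrite (eqP Es) (eqP Et) eqxx in h.
- exact: H1.
- exact: H2.
- by rewrite (eqP Es) (eqP Et) eqxx in h.
Qed.

Lemma tail_owner s t p : s \in F -> t \in F -> suffix p s -> suffix p t -> s = t.
Proof.
move=> sF tF /suffixP[s1 es] /suffixP[t1 et]; apply: ends_uniq => //.
by rewrite es et !last_cat_seg.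
Qed.

End Compatible.
End Complex.

(** * Flows *)

(** An initial part of a totally ordered set consists of its elements of least rank; only
    comparisons with [x] are involved. *)
Lemma rank_lt_card (T : finType) (S L : {set T}) (r : rel T) x :
  L \subset S -> r x x = false ->
  {in S, forall y, y != x -> r y x || r x y} ->
  {in S, forall y, r y x -> x \in L -> y \in L} ->
  {in L, forall y, r x y -> x \in L} -> x \in S ->
  (x \in L) = (#|[set y in S | r y x]| < #|L|)%N.
Proof.
move=> LS irr tot down up xS; apply/idP/idP => [xL|].
  apply: (@leq_trans #|L :\ x|.+1); last by rewrite (cardsD1 x L) xL.
  rewrite ltnS subset_leq_card //; apply/subsetP=> y; rewrite !inE => /andP[yS yx].
  by rewrite (down y) // andbT; apply: contraTneq yx => ->; rewrite irr.
apply: contraTT => xL; rewrite -leqNgt subset_leq_card //; apply/subsetP=> y yL.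
have yS := subsetP LS y yL; rewrite inE yS /=.
have yx : y != x by apply: contraNneq xL => <-.
by case/orP: (tot y yS yx) => // /(up y yL) xL'; rewrite xL' in xL.
Qed.

Lemma count_ltn_iota m n : count (fun i => i < m)%N (iota 0 n) = minn m n.
Proof.
elim: n => [|n IHn]; first by rewrite minn0.
by rewrite -addn1 iotaD count_cat IHn /= add0n; case: (ltnP n m) => /=; lia.
Qed.

(** The ranks of a strict total order on [S] run once through the integers below the cardinal of
    [S]. *)
Lemma card_rank_lt (T : finType) (S : {set T}) (r : rel T) m :
  {in S, irreflexive r} -> {in S & &, transitive r} ->
  {in S &, forall x y, x != y -> r x y || r y x} ->
  #|[set x in S | #|[set y in S | r y x]| < m]%N| = minn m #|S|.
Proof.
move=> irr tr tot; pose rk x := #|[set y in S | r y x]|.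
have rk_lt x y : x \in S -> y \in S -> r x y -> (rk x < rk y)%N.
  move=> xS yS xy; apply: proper_card; apply/properP; split.
    apply/subsetP=> z; rewrite !inE => /andP[zS zx]; rewrite zS /=.
    exact: (tr x z y).
  by exists x; rewrite inE xS ?xy //= irr.
have rkS x : x \in S -> (rk x < #|S|)%N.
  move=> xS; apply: proper_card; apply/properP; split.
    by apply/subsetP=> z; rewrite inE => /andP[].
  by exists x; rewrite // inE xS irr.
have rk_inj : {in S &, injective rk}.
  move=> x y xS yS exy; apply/eqP/negPn/negP => xy.
  by case/orP: (tot x y xS yS xy) => h; [have := rk_lt _ _ xS yS h|have := rk_lt _ _ yS xS h];
    rewrite exy ltnn.
have pe : perm_eq (map rk (enum S)) (iota 0 #|S|).
  have uq : uniq (map rk (enum S)).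
    by rewrite map_inj_in_uniq ?enum_uniq // => x y; rewrite !mem_enum; apply: rk_inj.
  apply: uniq_perm; rewrite ?iota_uniq //.
  have sub : {subset map rk (enum S) <= iota 0 #|S|}.
    by move=> _ /mapP[x + ->]; rewrite mem_enum mem_iota add0n => /rkS.
  have le : (size (iota 0 #|S|) <= size (map rk (enum S)))%N.
    by rewrite size_iota size_map -cardE.
  exact: (uniq_min_size uq sub le).2.
rewrite -(count_ltn_iota m #|S|) -(permP pe) count_map -sum1_count.
by rewrite big_enum_cond sum1dep_card.
Qed.

Lemma card_set_andb (T : finType) (P Q : pred T) :
  #|[set x | P x && Q x]| = (\sum_(x | P x) Q x)%N.
Proof. by rewrite -sum1dep_card big_mkcondr; apply: eq_bigr => x _; case: (Q x). Qed.

Section Flow.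
Variable lam : grid_shape.
Notation seg := (segment lam).
Implicit Types (F G A S : {set seg}) (p q s t : seg) (v w : point) (b : bool).

Definition extends (d : point -> point) F p : bool :=
  [exists q in tails F, vertices q == d (hd p) :: p].

Definition starts F v : nat := #|[set p in F | hd p == v]|.
(** A boolean is enough: by [ends_uniq] at most one member of a compatible family ends at [v]. *)
Definition ends F v : bool := [exists s in F, last origin s == v].
Definition through F v : nat := #|[set p in tails F | hd p == v]|.
Definition from d F v : nat := #|[set p in tails F | (hd p == v) && extends d F p]|.

(** A tail belongs to a single member, so what precedes it is unambiguous: nothing, a vertex to the
    west or a vertex to the north. *)
Lemma entry_count b F p : F \in compatible_family lam b -> p \in tails F ->
  (extends west F p + extends north F p + (p \in F))%N = 1%N.
Proof.
move=> Fb /tailsP[s sF [s1 es]].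
have own q : q \in tails F -> suffix p q -> exists2 s2, vertices s = s2 ++ q & q \in tails F.
  move=> qF pq; have [t tF [t1 et]] := tailsP _ _ qF; exists t1 => //.
  suff -> : s = t by [].
  apply: (tail_owner Fb sF tF (p := p)); first by rewrite es suffix_suffix.
  by apply: suffix_trans pq _; rewrite et suffix_suffix.
have extE d : extends d F p = (s1 != [::]) && (last origin s1 == d (hd p)).
  apply/exists_inP/andP => [[q qF /eqP eq]|[+ /eqP e]].
    have [|s2 es2 _] := own q qF; first by rewrite eq suffix_cons.
    move: es2; rewrite es eq -cat_rcons => /eqP.
    have [sz|sz] := eqVneq (size s1) (size (rcons s2 (d (hd p)))).
      by rewrite eqseq_cat // eqxx andbT => /eqP ->; rewrite last_rcons -size_eq0 size_rcons.
    by move/eqP/(congr1 size); rewrite !size_cat => /eqP; rewrite eqn_add2r (negPf sz).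
  case/lastP: s1 es e => // s2 w es + _; rewrite last_rcons => ew.
  have ws : is_segment lam (w :: p).
    by apply: (@is_segment_catr lam s2) => //; rewrite -cat_rcons -es; apply: segmentP.
  exists (Segment ws); last by rewrite /= ew.
  by apply/tailsP; exists s => //; exists s2; rewrite /= -cat_rcons.
have pE : (p \in F) = (s1 == [::]).
  apply/idP/eqP=> [pF|e]; last by rewrite e in es; have -> : p = s by apply: val_inj.
  have sp : s = p.
    by apply: (tail_owner Fb sF pF (p := p)); rewrite ?suffix_refl // es suffix_suffix.
  by move/(congr1 size): es; rewrite sp size_cat -[LHS]add0n => /eqP; rewrite eqn_add2r eq_sym size_eq0 => /eqP.
rewrite !extE pE; case: (lastP s1) es => [|s2 w] es /=; first by [].
rewrite -size_eq0 size_rcons /= last_rcons.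
have : is_segment lam (w :: p).
  by apply: (@is_segment_catr lam s2) => //; rewrite -cat_rcons -es; apply: segmentP.
rewrite is_segment_cons => /andP[_]; rewrite [X in X == [::]]seg_cons /=.
rewrite seg_stepE => /andP[+ _]; case: eqP => [->|_ /= ->] //.
by rewrite west_neq_north.
Qed.

Lemma card_tails_at F v (P : pred seg) :
  #|[set p in tails F | (hd p == v) && P p]| =
  (\sum_(p | (p \in tails F) && (hd p == v)) P p)%N.
Proof.
by rewrite -card_set_andb; congr #|pred_of_set _|; apply/setP=> p; rewrite !inE andbA.
Qed.

Lemma startsE F v : starts F v = #|[set p in tails F | (hd p == v) && (p \in F)]|.
Proof.
congr #|pred_of_set _|; apply/setP=> p; rewrite !inE andbCA andbC.
by congr (_ && _); apply/idP/andP=> [pF|[]//]; rewrite pF sub_tails.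
Qed.

Lemma from_starts b F v : F \in compatible_family lam b ->
  #|[set p in tails F | (hd p == v) && (extends west F p || (p \in F))]| =
  (from west F v + starts F v)%N.
Proof.
move=> Fb; rewrite startsE /from !card_tails_at -big_split; apply: eq_bigr => p /andP[pF _].
have /= := entry_count Fb pF.
by case: (extends west F p); case: (extends north F p); case: (p \in F).
Qed.

Lemma through_out b F v : F \in compatible_family lam b ->
  through F v = (from west F v + starts F v + from north F v)%N.
Proof.
move=> Fb; rewrite startsE /from !card_tails_at -!big_split /through -sum1dep_card.
by apply: eq_bigr => p /andP[pF _]; rewrite -(entry_count Fb pF) addnAC.
Qed.

(** Sorts paths out of [v] by their first step. The sets are arbitrary so that the count serves both
    the tails of a family and the paths of [grow]; the guard makes [v :: q] a segment. *)
Lemma card_by_tail v (e : bool) (S1 S2 : {set seg}) :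
  [|| e, S1 != set0 | S2 != set0] ==> interior lam v ->
  {in S1, forall q, hd q = east v} -> {in S2, forall q, hd q = south v} ->
  #|[set p : seg | [|| (vertices p == [:: v]) && e,
      [exists q in S1, vertices p == v :: q] | [exists q in S2, vertices p == v :: q]]]|
  = (e + #|S1| + #|S2|)%N.
Proof.
move=> /implyP vint h1 h2.
have cons_seg S q : S = S1 \/ S = S2 -> q \in S -> is_segment lam (v :: q).
  move=> HS qS; rewrite is_segment_cons vint ?segmentP ?andbT /=; last first.
    by apply/or3P; case: HS qS => -> qS; [apply: Or32|apply: Or33]; apply/set0Pn; exists q.
  apply/orP; right; rewrite /seg_step.
  by case: HS qS => -> /= => [/h1 ->|/h2 ->]; rewrite eqxx ?orbT.
(* The default is never reached on [S1] and [S2], where [v :: q] is a segment. *)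
pose f q := odflt q (insub (v :: vertices q)).
have fE S q : S = S1 \/ S = S2 -> q \in S -> vertices (f q) = v :: q.
  by move=> HS qS; rewrite /f (insubT _ (cons_seg S q HS qS)).
have cardf S : S = S1 \/ S = S2 -> #|[set p : seg | [exists q in S, vertices p == v :: q]]| = #|S|.
  move=> HS; rewrite -(@card_in_imset _ _ f S) => [|q q' qS qS' /(congr1 val) /=].
    congr #|pred_of_set _|; apply/setP=> p; rewrite inE; apply/exists_inP/imsetP => [[q qS /eqP eq]|[q qS ->]].
      by exists q => //; apply: val_inj; rewrite /= (fE S).
    by exists q => //; rewrite (fE S).
  by rewrite !(fE S) // => -[] /val_inj.
rewrite -(cardf S1 (or_introl erefl)) -(cardf S2 (or_intror erefl)).
set X1 := [set p : seg | [exists q in S1, _]]; set X2 := [set p : seg | [exists q in S2, _]].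
set X0 := [set p : seg | (vertices p == [:: v]) && e].
have -> : (e : nat) = #|X0|.
  rewrite /X0; case: (e) vint => vint /=; last first.
    by apply/esym/eqP; rewrite cards_eq0; apply/eqP/setP=> p; rewrite !inE andbF.
  have vs : is_segment lam [:: v] by rewrite is_segment_cons vint.
  rewrite -(cards1 (Segment vs)); congr #|pred_of_set _|; apply/setP=> p; rewrite !inE andbT.
  by apply/eqP/eqP=> [->//|h]; apply: val_inj.
have X01 : X0 :&: X1 = set0.
  apply/setP=> p; rewrite !inE; apply/negbTE/negP => /andP[/andP[/eqP ep _]].
  by case/exists_inP=> q _; rewrite ep [vertices q]seg_cons eqseq_cons andbF.
have X012 : (X0 :|: X1) :&: X2 = set0.
  apply/setP=> p; rewrite !inE; apply/negbTE/negP => /andP[/orP[]].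
    by case/andP=> /eqP ep _ /exists_inP[q _]; rewrite ep [vertices q]seg_cons eqseq_cons andbF.
  case/exists_inP=> q qS /eqP -> /exists_inP[q' qS']; rewrite eqseq_cons eqxx /=.
  move/eqP/(congr1 (head origin)); rewrite h1 // h2 // => /eqP.
  by rewrite point_eqE /=; lia.
have := cardsUI X0 X1; rewrite X01 cards0 addn0 => <-.
have := cardsUI (X0 :|: X1) X2; rewrite X012 cards0 addn0 => <-; congr #|pred_of_set _|; apply/setP=> p.
by rewrite !inE orbA.
Qed.

(** [through_out] sorts the passages by what precedes them, this one by what follows. The two
    balance equations let the flow be computed level by level in [grow_card]. *)
Lemma through_in F v :
  through F v = (ends F v + from west F (east v) + from north F (south v))%N.
Proof.
rewrite /through /from -(@card_by_tail v); last 3 first.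
- apply/implyP => /or3P[/exists_inP[s _ /eqP <-]|/set0Pn[q]|/set0Pn[q]].
  + exact: last_interior.
  + rewrite inE => /and3P[_ /eqP h /exists_inP[p _ /eqP]]; rewrite h -westE => ep.
    by apply: (seg_interior (p := p)); rewrite ep mem_head.
  + rewrite inE => /and3P[_ /eqP h /exists_inP[p _ /eqP]]; rewrite h -northE => ep.
    by apply: (seg_interior (p := p)); rewrite ep mem_head.
- by move=> q; rewrite inE => /and3P[_ /eqP].
- by move=> q; rewrite inE => /and3P[_ /eqP].
congr #|pred_of_set _|; apply/setP=> p; rewrite [LHS]in_set [RHS]in_set.
have [ep|np] := eqVneq (vertices p) [:: v].
  rewrite ep eqxx /=. rewrite [X in _ || X](_ : _ = false) ?orbF; last first.
    by apply/negbTE/negP => /orP[]/exists_inP[q _]; rewrite [vertices q]seg_cons eqseq_cons andbF.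
  rewrite andbT; apply/tailsP/exists_inP => [[s sF [s1 es]]|[s sF /eqP es]]; exists s => //.
    by rewrite es last_cat ep.
  exists (belast (hd s) (behead s)); rewrite ep -es.
  by rewrite [in LHS]seg_cons lastI cats1 [in RHS]seg_cons.
apply/andP/idP => [[pF /eqP hp]|/orP[/andP[]//|/orP[]]].
- apply/orP; right; have ps := segmentP p; rewrite [vertices p]seg_cons hp in np ps.
  case E: (behead p) np ps => [|w q'] np; first by rewrite eqxx in np.
  rewrite is_segment_cons /= => /and3P[_ vw qs].
  have [q eq] : exists q : seg, vertices q = w :: q' by exists (Segment qs).
  have ep : vertices p = v :: q by rewrite eq -E -hp -seg_cons.
  have qF := tails_cons pF ep.
  have ext d : d (hd q) = v -> extends d F q.
    by move=> dv; apply/exists_inP; exists p; rewrite // ep dv.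
  have hq : hd q = w by rewrite eq.
  case/orP: vw => /eqP ew; apply/orP; [right|left]; apply/exists_inP;
    (exists q; last by rewrite ep eqxx); rewrite in_set qF hq ew eqxx ext // hq ew -?westE -?northE //.
- case/exists_inP=> q; rewrite inE => /and3P[_ /eqP hq /exists_inP[p' p'F /eqP]].
  rewrite hq -westE => ep' /eqP ep; have -> : p = p' by apply: val_inj; rewrite /= ep ep'.
  by rewrite p'F ep' eqxx.
- case/exists_inP=> q; rewrite inE => /and3P[_ /eqP hq /exists_inP[p' p'F /eqP]].
  rewrite hq -northE => ep' /eqP ep; have -> : p = p' by apply: val_inj; rewrite /= ep ep'.
  by rewrite p'F ep' eqxx.
Qed.
End Flow.

(** * Rebuilding a family from its flow *)

Section Regrow.
Variable lam : grid_shape.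
Notation seg := (segment lam).
Implicit Types (F G A S : {set seg}) (p q s t : seg) (v w : point) (b : bool).

(** A crude strict bound for the levels of interior vertices: no segment starts at this level, so
    [grow] may begin with the empty set. *)
Definition level_bound : nat := (\sum_(v <- enum_fset lam) `|lev v|).+1.

Lemma interior_lev v : interior lam v -> (`|lev v| < level_bound)%N.
Proof.
case/andP=> /andP[vl _] _; rewrite /level_bound ltnS.
rewrite (big_rem v) /=; last exact: vl.
exact: leq_addr.
Qed.

Definition seg_below b q p : bool := (hd q == hd p) && below b (hd p) (behead q) (behead p).

Definition rank b A p : nat := #|[set q in A | seg_below b q p]|.

(* The paths starting at level [level_bound - n] that the flow of F forces in
   a b-compatible family: at each vertex they are sorted by [seg_below], the
   lowest ones come from the west and the highest ones from the north. *)
Fixpoint grow b F (n : nat) : {set seg} :=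
  if n is m.+1 then
    [set p : seg | [||
      (vertices p == [:: hd p]) && ((lev (hd p) == level_bound%:Z - n%:Z) && ends F (hd p)),
      [exists q in grow b F m, (vertices p == west (hd q) :: q) &&
         (rank b (grow b F m) q < from west F (hd q))%N] |
      [exists q in grow b F m, (vertices p == north (hd q) :: q) &&
         (from west F (hd q) + starts F (hd q) <= rank b (grow b F m) q)%N]]]
  else set0.

Definition depth v : nat := `|(level_bound%:Z - lev v)%R|.

(** The ranks between the paths from the west and those from the north belong to the paths that
    nothing precedes, that is, to whole segments. *)
Definition regrow b F : {set seg} :=
  [set p : seg | let A := grow b F (depth (hd p)) in
    [&& p \in A, (from west F (hd p) <= rank b A p)%N &
       (rank b A p < from west F (hd p) + starts F (hd p))%N]].

Lemma depthE v n : lev v = level_bound%:Z - n%:Z -> depth v = n.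
Proof. by rewrite /depth => ->; lia. Qed.

Lemma lev_west v : lev (west v) = lev v - 1. Proof. rewrite /lev /=; lia. Qed.
Lemma lev_north v : lev (north v) = lev v - 1. Proof. rewrite /lev /=; lia. Qed.

Lemma growS b F n p : (p \in grow b F n.+1) =
  [|| (vertices p == [:: hd p]) && ((lev (hd p) == level_bound%:Z - n.+1%:Z) && ends F (hd p)),
      [exists q in grow b F n, (vertices p == west (hd q) :: q) &&
         (rank b (grow b F n) q < from west F (hd q))%N] |
      [exists q in grow b F n, (vertices p == north (hd q) :: q) &&
         (from west F (hd q) + starts F (hd q) <= rank b (grow b F n) q)%N]].
Proof. by rewrite in_set. Qed.

Lemma grow_lev b F n p : p \in grow b F n -> lev (hd p) = level_bound%:Z - n%:Z.
Proof.
elim: n p => [|n IHn] p; first by rewrite inE.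
rewrite growS => /or3P[/and3P[_ /eqP]//|/exists_inP[q /IHn hq]|/exists_inP[q /IHn hq]];
  by case/andP=> /eqP-> _ /=; rewrite (lev_west, lev_north) hq; lia.
Qed.

Lemma seg_below_irr b p : seg_below b p p = false.
Proof. by rewrite /seg_below below_irr andbF. Qed.

Lemma seg_below_trans b : transitive (seg_below b).
Proof.
move=> q p r /andP[/eqP pq h1] /andP[/eqP qr h2]; rewrite /seg_below pq qr eqxx /=.
have pp := seg_path p; have qp := seg_path q; have rp := seg_path r.
rewrite pq qr in pp; rewrite qr in qp h1.
exact: below_trans h1 h2.
Qed.

Lemma seg_below_total b p q : hd p = hd q -> p != q -> seg_below b p q || seg_below b q p.
Proof.
move=> pq npq; rewrite /seg_below pq eqxx /=.
have pp := seg_path p; rewrite pq in pp; apply: below_total; rewrite ?seg_path //.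
by apply: contraNneq npq => e; rewrite -val_eqE /= (seg_cons p) (seg_cons q) pq e.
Qed.

Lemma rank_hd b A p v : hd p = v ->
  rank b A p = #|[set q in [set q in A | hd q == v] | seg_below b q p]|.
Proof.
move=> hp; congr #|pred_of_set _|; apply/setP=> q; rewrite !inE -andbA.
by congr (_ && _); rewrite /seg_below hp; case: (hd q == v).
Qed.

Lemma card_rank_lt_hd b A v m :
  #|[set q in A | (hd q == v) && (rank b A q < m)%N]| = minn m #|[set q in A | hd q == v]|.
Proof.
rewrite -(@card_rank_lt _ _ (seg_below b) m).
- congr #|pred_of_set _|; apply/setP=> q; rewrite !inE -andbA; congr (_ && _).
  by case: eqP => //= hq; rewrite (rank_hd _ _ hq).
- by move=> x _; apply: seg_below_irr.
- by move=> x y z _ _ _; apply: seg_below_trans.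
- move=> x y; rewrite !inE => /andP[_ /eqP hx] /andP[_ /eqP hy] xy.
  by apply: seg_below_total; rewrite ?hx ?hy.
Qed.

Section Source.
Variables (b : bool) (F : {set seg}).
Hypothesis Fb : F \in compatible_family lam b.

Lemma extendsP (d : point -> point) p : p \in tails F -> extends d F p ->
  exists s (s1 : seq point), [/\ s \in F, vertices s = s1 ++ p, s1 != [::] & last origin s1 = d (hd p)].
Proof.
move=> pF /exists_inP[q /tailsP[s sF [s1 es]] /eqP eq].
exists s, (rcons s1 (d (hd p))); rewrite last_rcons -size_eq0 size_rcons; split=> //.
by rewrite cat_rcons -eq.
Qed.

Lemma tails_entry p : p \in tails F -> [|| extends west F p, p \in F | extends north F p].
Proof.
by move/(entry_count Fb); case: (extends west F p); case: (p \in F); case: (extends north F p).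
Qed.

Lemma entry_northN p : p \in tails F -> extends north F p -> (p \in F) = false /\ extends west F p = false.
Proof.
by move/(entry_count Fb) => + pw; rewrite pw; case: (p \in F); case: (extends west F p).
Qed.

Lemma below_entry_mono p q : p \in tails F -> q \in tails F -> seg_below b p q ->
  extends north F p || (p \in F) -> extends west F q || (q \in F) -> False.
Proof.
have H r (d : point -> point) : r \in tails F -> extends d F r || (r \in F) ->
    exists s (s1 : seq point), [/\ s \in F, vertices s = s1 ++ r & enters d s1 r].
  move=> rT /orP[/(extendsP rT)[s [s1 [sF es _ e]]]|rF].
    by exists s, s1; rewrite /enters e eqxx orbT.
  by exists r, [::].
move=> pF qF /andP[/eqP pq pbq] /(H _ _ pF)[s [s1 [sF es e1]]] /(H _ _ qF)[t [t1 [tF et e2]]].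
by apply: (@below_entry lam b F Fb s t s1 t1 p q) => //; rewrite pq.
Qed.

(** By [below_entry_mono] the tails that come from the west form an initial part of the tails at
    their vertex. *)
Lemma rank_west p : p \in tails F ->
  extends west F p = (rank b (tails F) p < from west F (hd p))%N.
Proof.
move=> pF; rewrite (rank_hd b (tails F) erefl) /from.
set L := [set q in tails F | _ & _].
have -> : extends west F p = (p \in L) by rewrite in_set pF eqxx.
apply: rank_lt_card; rewrite ?seg_below_irr ?in_set ?pF ?eqxx //.
- by apply/subsetP=> q; rewrite !in_set => /and3P[-> ->].
- by move=> q; rewrite in_set => /andP[_ /eqP hq] qp; apply: seg_below_total.
- move=> q; rewrite !in_set => /andP[qF hq] qp /and3P[_ _ pw]; rewrite qF hq /=.
  case/or3P: (tails_entry qF) => // h; exfalso;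
    by apply: (below_entry_mono qF pF qp); rewrite ?h ?pw ?orbT.
- move=> q; rewrite !in_set ?pF ?eqxx /= => /and3P[qF hq qw] pq.
  case/or3P: (tails_entry pF) => // h; exfalso;
    by apply: (below_entry_mono pF qF pq); rewrite ?h ?qw ?orbT.
Qed.

Lemma rank_start p : p \in tails F ->
  extends west F p || (p \in F) =
  (rank b (tails F) p < from west F (hd p) + starts F (hd p))%N.
Proof.
move=> pF; rewrite (rank_hd b (tails F) erefl).
pose L := [set q in tails F | (hd q == hd p) && (extends west F q || (q \in F))].
have <- : #|L| = (from west F (hd p) + starts F (hd p))%N.
  exact: from_starts Fb.
have -> : extends west F p || (p \in F) = (p \in L) by rewrite in_set pF eqxx.
apply: rank_lt_card; rewrite ?seg_below_irr ?in_set ?pF ?eqxx //.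
- by apply/subsetP=> q; rewrite !in_set => /and3P[-> ->].
- by move=> q; rewrite in_set => /andP[_ /eqP hq] qp; apply: seg_below_total.
- move=> q; rewrite !in_set => /andP[qF hq] qp /and3P[_ _ pw]; rewrite qF hq /=.
  case/or3P: (tails_entry qF) => h; rewrite ?h ?orbT //; exfalso.
  by apply: (below_entry_mono qF pF qp); rewrite ?h ?pw.
- move=> q; rewrite !in_set ?pF ?eqxx /= => /and3P[qF hq qw] pq.
  case/or3P: (tails_entry pF) => h; rewrite ?h ?orbT //; exfalso.
  by apply: (below_entry_mono pF qF pq); rewrite ?h ?qw.
Qed.

Lemma rank_tails_grow n p : (forall q, (q \in grow b F n) =
    (q \in tails F) && (lev (hd q) == level_bound%:Z - n%:Z)) ->
  lev (hd p) = level_bound%:Z - n%:Z -> rank b (grow b F n) p = rank b (tails F) p.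
Proof.
move=> E hp; congr #|pred_of_set _|; apply/setP=> q; rewrite [LHS]in_set [RHS]in_set E -andbA.
by congr (_ && _); rewrite /seg_below; case: (hd q =P hd p) => [->|]; rewrite ?andbF // hp eqxx.
Qed.

Lemma tails_seg1 p v : vertices p = [:: v] -> (p \in tails F) = ends F v.
Proof.
move=> ep; apply/tailsP/exists_inP => [[s sF [s1 es]]|[s sF /eqP es]]; exists s => //.
  by rewrite es last_cat ep.
exists (belast (hd s) (behead s)); rewrite ep -es.
by rewrite [in LHS]seg_cons lastI cats1 [in RHS]seg_cons.
Qed.

(** By [rank_west] and [rank_start], the rank of a path decides its preceding step exactly as the
    compatible family does. *)
Lemma grow_tails n p :
  (p \in grow b F n) = (p \in tails F) && (lev (hd p) == level_bound%:Z - n%:Z).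
Proof.
elim: n p => [|n IHn] p.
  rewrite inE; apply/esym/negbTE; rewrite negb_and; apply/orP; right.
  by have := interior_lev (hd_interior p); lia.
have [lp|lp] := eqVneq (lev (hd p)) (level_bound%:Z - n.+1%:Z); last first.
  rewrite andbF; apply/negbTE/negP => /grow_lev E; by rewrite E eqxx in lp.
rewrite andbT growS lp eqxx /=.
have [ep|np] := eqVneq (vertices p) [:: hd p].
  rewrite andTb (tails_seg1 ep); case: (ends F _) => //=.
  apply/negbTE/negP => /orP[]/exists_inP[q _ /andP[+ _]];
    by rewrite ep [vertices q]seg_cons eqseq_cons andbF.
rewrite /=; apply/idP/idP.
  case/orP=> /exists_inP[q + /andP[/eqP ep]]; rewrite IHn => /andP[qF /eqP lq];
    rewrite (rank_tails_grow IHn lq) => rq.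
    move: rq; rewrite -rank_west // => /exists_inP[p' p'F /eqP ep'].
    by have -> : p = p' by apply: val_inj; rewrite /= ep ep'.
  move: rq; rewrite leqNgt -rank_start // negb_or => /andP[h1 h2].
  have := tails_entry qF; rewrite (negPf h1) (negPf h2) /= => /exists_inP[p' p'F /eqP ep'].
  by have -> : p = p' by apply: val_inj; rewrite /= ep ep'.
move=> pF; have ps := segmentP p; rewrite [vertices p]seg_cons in np ps.
case E: (behead p) np ps => [|w q'] np; first by rewrite eqxx in np.
rewrite is_segment_cons /= => /and3P[_ vw qs].
have [q eq] : exists q : seg, vertices q = w :: q' by exists (Segment qs).
have ep : vertices p = hd p :: q by rewrite eq -E -seg_cons.
have qF := tails_cons pF ep.
have hq : hd q = w by rewrite eq.
have lq : lev (hd q) = level_bound%:Z - n%:Z.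
  by rewrite hq (lev_step vw) lp; lia.
have qG : q \in grow b F n by rewrite IHn qF lq eqxx.
have ext d : hd p = d w -> extends d F q.
  by move=> dv; apply/exists_inP; exists p; rewrite // hq -dv -ep.
move: vw; rewrite seg_stepE => /orP[]/eqP ev; apply/orP; [left|right]; apply/exists_inP; exists q => //;
  rewrite hq -ev -ep eqxx /= (rank_tails_grow IHn lq) -hq.
  by rewrite -rank_west // ext.
have [h1 h2] := entry_northN qF (ext _ ev).
by rewrite leqNgt -rank_start // h1 h2.
Qed.

Lemma hd_depth p : lev (hd p) = level_bound%:Z - (depth (hd p))%:Z.
Proof. by have := interior_lev (hd_interior p); rewrite /depth; lia. Qed.

Lemma regrow_id : regrow b F = F.
Proof.
apply/setP=> p; rewrite in_set /= grow_tails -hd_depth eqxx andbT.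
have [pF|pF] := boolP (p \in tails F); last first.
  by apply/esym/negbTE; apply: contraNN pF; apply: sub_tails.
rewrite (rank_tails_grow (grow_tails _) (hd_depth p)) -rank_start // leqNgt -rank_west //.
by have := entry_count Fb pF; case: (extends west F p); case: (p \in F); case: (extends north F p).
Qed.

End Source.

(** The recursion reads the family only through its flow. *)
Lemma grow_ext b F G n : starts F =1 starts G -> ends F =1 ends G ->
  from west F =1 from west G -> grow b F n = grow b G n.
Proof.
move=> h1 h2 h3; elim: n => //= n ->; apply/setP=> p; rewrite !in_set h2.
by congr [|| _, _ | _]; apply: eq_existsb => q; rewrite h3 ?h1.
Qed.

Lemma regrow_ext b F G : starts F =1 starts G -> ends F =1 ends G ->
  from west F =1 from west G -> regrow b F = regrow b G.
Proof.
by move=> h1 h2 h3; apply/setP=> p; rewrite !in_set (grow_ext b _ h1 h2 h3) h3 h1.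
Qed.

End Regrow.

(** * Flow and compatibility of the rebuilt family *)

Section RegrowCorrect.
Variable lam : grid_shape.
Notation seg := (segment lam).
Implicit Types (F G A S : {set seg}) (p q s t : seg) (v w : point).
Lemma ends_interior F v : ends F v -> interior lam v.
Proof. by case/exists_inP=> s _ /eqP <-; apply: last_interior. Qed.

(** Two independent booleans: the flow comes from a family compatible for [b0], while the paths are
    sorted according to [b]. *)
Variables (b0 b : bool) (F : {set seg}).
Hypothesis Fb : F \in compatible_family lam b0.

Lemma from_interior (d : point -> point) v : (0 < from d F v)%N -> interior lam (d v).
Proof.
rewrite card_gt0 => /set0Pn[p]; rewrite in_set => /and3P[_ /eqP hp /exists_inP[q _ /eqP eq]].
by have := hd_interior q; rewrite eq /= hp.
Qed.

Lemma starts_le1 v : (starts F v <= 1)%N.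
Proof.
rewrite leqNgt; apply/negP => /card_gt1P[x [y []]]; rewrite !in_set.
move=> /andP[xF /eqP hx] /andP[yF /eqP hy]; apply/negP; rewrite negbK; apply/eqP.
by apply: (starts_uniq Fb) => //; rewrite hx hy.
Qed.

Lemma grow_west_card n v : #|[set p in grow b F n | hd p == v]| = through F v ->
  #|[set p in grow b F n | (hd p == v) && (rank b (grow b F n) p < from west F v)%N]|
  = from west F v.
Proof.
by move=> E; rewrite card_rank_lt_hd E (through_out _ Fb) -addnA; apply/minn_idPl/leq_addr.
Qed.

Lemma grow_start_card n v : #|[set p in grow b F n | hd p == v]| = through F v ->
  #|[set p in grow b F n | (hd p == v) &&
      (rank b (grow b F n) p < from west F v + starts F v)%N]|
  = (from west F v + starts F v)%N.
Proof.
by move=> E; rewrite card_rank_lt_hd E (through_out _ Fb); apply/minn_idPl/leq_addr.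
Qed.

Lemma grow_north_card n v : #|[set p in grow b F n | hd p == v]| = through F v ->
  #|[set p in grow b F n | (hd p == v) &&
      (from west F v + starts F v <= rank b (grow b F n) p)%N]|
  = from north F v.
Proof.
move=> E; have := grow_start_card E; have := E.
rewrite (through_out _ Fb) => + h.
rewrite -(cardsID [set p | (rank b (grow b F n) p < from west F v + starts F v)%N]).
rewrite [X in (X + _)%N](_ : _ = (from west F v + starts F v)%N); last first.
  by rewrite -[RHS]h; congr #|pred_of_set _|; apply/setP=> p; rewrite !inE andbA.
move/addnI => <-; congr #|pred_of_set _|; apply/setP=> p.
by rewrite !inE -leqNgt andbA andbC.
Qed.

(** However the paths are sorted, their number is governed by the balance equations, which [grow]
    satisfies by construction. *)
Lemma grow_card n v : lev v = (level_bound lam)%:Z - n%:Z ->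
  #|[set p in grow b F n | hd p == v]| = through F v.
Proof.
elim: n v => [|n IHn] v lv.
  rewrite [LHS](_ : _ = 0%N); last first.
    by apply/eqP; rewrite cards_eq0; apply/eqP/setP=> p; rewrite !inE.
  apply/esym/eqP; rewrite cards_eq0; apply/eqP/setP=> p; rewrite !inE.
  apply/negbTE/negP => /andP[_ /eqP hp].
  by have := interior_lev (hd_interior p); rewrite hp lv; lia.
have le : lev (east v) = (level_bound lam)%:Z - n%:Z by rewrite /lev /= in lv *; lia.
have ls : lev (south v) = (level_bound lam)%:Z - n%:Z by rewrite /lev /= in lv *; lia.
rewrite through_in -(grow_west_card (IHn _ le)) -(grow_north_card (IHn _ ls)).
rewrite -(@card_by_tail lam v); last 3 first.
- rewrite -!card_gt0 (grow_west_card (IHn _ le)) (grow_north_card (IHn _ ls)).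
  apply/implyP => /or3P[/ends_interior//|/from_interior|/from_interior];
    by rewrite -?westE -?northE.
- by move=> q; rewrite in_set => /and3P[_ /eqP].
- by move=> q; rewrite in_set => /and3P[_ /eqP].
congr #|pred_of_set _|; apply/setP=> p; rewrite [LHS]in_set [RHS]in_set growS.
have step (d e : point -> point) (P : pred seg) (Q : seg -> bool) :
    (forall v, v = d (e v)) -> (forall w, w = e (d w)) ->
    (forall q, hd q = e v -> P q = Q q) ->
  [exists q in grow b F n, (vertices p == d (hd q) :: q) && P q] && (hd p == v) =
  [exists q in [set q in grow b F n | (hd q == e v) && Q q], vertices p == v :: q].
  move=> de ed PQ; apply/andP/exists_inP => [[/exists_inP[q qG /andP[/eqP ep Pq]] /eqP]|[q]].
    rewrite ep /= => hq; have hq' : hd q = e v by rewrite -hq -ed.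
    exists q; last by rewrite hq' -de eqxx.
    by rewrite in_set qG hq' eqxx -PQ.
  rewrite in_set => /and3P[qG /eqP hq Qq] /eqP ep; rewrite ep eqxx; split=> //.
  by apply/exists_inP; exists q => //; rewrite hq -de eqxx PQ.
rewrite !andb_orl (step west east _ (fun q => (rank b (grow b F n) q < from west F (east v))%N)).
- rewrite (step north south _ (fun q => (from west F (south v) + starts F (south v)
      <= rank b (grow b F n) q)%N)).
  + congr [|| _ , _ | _]; apply/andP/andP => -[].
      by move=> /and3P[/eqP ep _ h] /eqP hp; rewrite hp in ep h; rewrite ep.
    by move=> /eqP -> h; rewrite /= !eqxx /= lv eqxx.
  + exact: northE.
  + by case=> x y; congr pair => /=; lia.
  + by move=> q ->.
- exact: westE.
- by case=> x y; congr pair => /=; lia.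
- by move=> q ->.
Qed.

Let G := regrow b F.

Lemma depth_lev v : interior lam v -> lev v = (level_bound lam)%:Z - (depth lam v)%:Z.
Proof. by move/interior_lev; rewrite /depth; lia. Qed.

Lemma level_pred (k l : int) n m : k = m - n%:Z -> k = l + 1 -> l = m - n.+1%:Z.
Proof. lia. Qed.

Lemma grow_behead n p q v : q \in grow b F n.+1 -> vertices q = v :: p -> p \in grow b F n.
Proof.
rewrite growS => /or3P[/andP[/eqP -> _]|/exists_inP[r rG /andP[/eqP-> _]]|/exists_inP[r rG /andP[/eqP-> _]]].
- by rewrite [vertices p]seg_cons.
- by case=> _ /val_inj <-.
- by case=> _ /val_inj <-.
Qed.

Lemma mem_regrow n p : lev (hd p) = (level_bound lam)%:Z - n%:Z ->
  (p \in G) = [&& p \in grow b F n, (from west F (hd p) <= rank b (grow b F n) p)%N &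
       (rank b (grow b F n) p < from west F (hd p) + starts F (hd p))%N].
Proof. by move=> /depthE dp; rewrite in_set /= dp. Qed.

Lemma tails_regrow_sub p : p \in tails G -> p \in grow b F (depth lam (hd p)).
Proof.
move=> /tailsP[s sG [s1]]; elim/last_ind: s1 p => [|s1 w IHs] p es.
  have -> : p = s by apply: val_inj; rewrite /= es.
  by move: sG; rewrite (mem_regrow (depth_lev (hd_interior s))) => /and3P[].
rewrite cat_rcons in es.
have ws : is_segment lam (w :: p).
  by apply: (@is_segment_catr lam s1) => //; rewrite -es; apply: segmentP.
have /= := IHs (Segment ws) es.
have wp : lev (hd p) = lev w + 1.
  by apply: lev_step; move: ws; rewrite is_segment_cons [X in X == [::]]seg_cons /= => /and3P[].
have := depth_lev (hd_interior (Segment ws)); have := depth_lev (hd_interior p) => /=.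
rewrite wp => e1 e2; have -> : depth lam w = (depth lam (hd p)).+1.
  by move: e1 e2; move: (depth lam (hd p)) (depth lam w) (lev w) => d d' l; lia.
by move/grow_behead; apply.
Qed.

Lemma grow_west_next n p : p \in grow b F n ->
  (rank b (grow b F n) p < from west F (hd p))%N =
  [exists q in grow b F n.+1, vertices q == west (hd p) :: p].
Proof.
move=> pG; apply/idP/exists_inP => [rp|[q + /eqP eq]].
  have wi : interior lam (west (hd p)) by apply: from_interior; apply: leq_ltn_trans rp.
  have ws : is_segment lam (west (hd p) :: p).
    by rewrite is_segment_cons wi segmentP seg_stepE eqxx orbT.
  exists (Segment ws) => //; rewrite growS; apply/or3P/Or32/exists_inP.
  by exists p; rewrite // eqxx.
rewrite growS eq => /or3P[/andP[]|/exists_inP[r rG /andP[]]|/exists_inP[r _ /andP[]]];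
  rewrite eqseq_cons => /andP[].
- by rewrite [vertices p]seg_cons.
- by move=> _ /eqP/val_inj <-.
- by move=> /eqP ew /eqP/val_inj er; move: ew; rewrite er => /eqP; rewrite west_neq_north.
Qed.

Lemma grow_north_next n p : p \in grow b F n ->
  (from west F (hd p) + starts F (hd p) <= rank b (grow b F n) p)%N =
  [exists q in grow b F n.+1, vertices q == north (hd p) :: p].
Proof.
move=> pG; apply/idP/exists_inP => [rp|[q + /eqP eq]].
  have wi : interior lam (north (hd p)).
    apply: from_interior; rewrite -(grow_north_card (grow_card (grow_lev pG))).
    by rewrite card_gt0; apply/set0Pn; exists p; rewrite in_set pG eqxx.
  have ws : is_segment lam (north (hd p) :: p).
    by rewrite is_segment_cons wi segmentP seg_stepE eqxx !orbT.
  exists (Segment ws) => //; rewrite growS; apply/or3P/Or33/exists_inP.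
  by exists p; rewrite // eqxx.
rewrite growS eq => /or3P[/andP[]|/exists_inP[r _ /andP[]]|/exists_inP[r rG /andP[]]];
  rewrite eqseq_cons => /andP[].
- by rewrite [vertices p]seg_cons.
- by move=> /eqP ew /eqP/val_inj er; move: ew; rewrite er => /eqP; rewrite eq_sym west_neq_north.
- by move=> _ /eqP/val_inj <-.
Qed.

(** A grown path either belongs to [G] or is prolonged backwards, and the prolongation must stop
    inside the finite shape. *)
Lemma grow_sub_tails n p : p \in grow b F n -> p \in tails G.
Proof.
(* Interior vertices have levels above [- level_bound lam], so [n] stays below twice the bound. *)
have [m] := ubnP (level_bound lam + level_bound lam - n)%N.
elim: m n p => // m IHm n p; rewrite ltnS => nm pG.
have lp := grow_lev pG.
have nlt : (n < level_bound lam + level_bound lam)%N.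
  by have := interior_lev (hd_interior p); rewrite lp; lia.
have nxt v : [exists q in grow b F n.+1, vertices q == v :: p] -> p \in tails G.
  case/exists_inP=> q qG /eqP eq; apply: tails_cons eq; apply: IHm qG; lia.
have [rw|rw] := ltnP (rank b (grow b F n) p) (from west F (hd p)).
  by apply: (nxt (west (hd p))); rewrite -grow_west_next.
have [rs|rs] := ltnP (rank b (grow b F n) p) (from west F (hd p) + starts F (hd p)).
  by apply: sub_tails; rewrite (mem_regrow lp) pG rw rs.
by apply: (nxt (north (hd p))); rewrite -grow_north_next.
Qed.

Lemma tails_regrow n p : lev (hd p) = (level_bound lam)%:Z - n%:Z ->
  (p \in tails G) = (p \in grow b F n).
Proof.
move=> lp; apply/idP/idP; last exact: grow_sub_tails.
by move/tails_regrow_sub; rewrite (depthE lp).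
Qed.

Lemma card_no_hd v (A : {set seg}) (P : pred seg) : ~~ interior lam v ->
  #|[set p in A | (hd p == v) && P p]| = 0%N.
Proof.
move=> iv; apply/eqP; rewrite cards_eq0; apply/eqP/setP=> p; rewrite !inE.
apply/negbTE/negP => /and3P[_ /eqP hp _]; by rewrite -hp hd_interior in iv.
Qed.

Lemma through_regrow : through G =1 through F.
Proof.
move=> v; have [iv|iv] := boolP (interior lam v); last first.
  have E A : #|[set p in tails A | hd p == v]| = 0%N.
    rewrite -[RHS](card_no_hd (tails A) predT iv); congr #|pred_of_set _|.
    by apply/setP=> p; rewrite !in_set andbT.
  by rewrite /through !E.
rewrite -(grow_card (depth_lev iv)); congr #|pred_of_set _|; apply/setP=> p.
rewrite !in_set; case: eqP => [hp|_]; rewrite ?andbF // !andbT.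
by apply: tails_regrow; rewrite hp depth_lev.
Qed.

Lemma from_west_regrow : from west G =1 from west F.
Proof.
move=> v; have [iv|iv] := boolP (interior lam v); last by rewrite /from !card_no_hd.
rewrite -(grow_west_card (grow_card (depth_lev iv))); congr #|pred_of_set _|.
apply/setP=> p; rewrite !in_set; have [hp|_] := eqVneq (hd p) v; rewrite ?andbF //= -hp.
rewrite (tails_regrow (depth_lev (hd_interior p))).
have [pG|//] := boolP (p \in grow _ _ _); rewrite grow_west_next //.
apply: eq_existsb => q; have [eq|_] := eqVneq (vertices q) (west (hd p) :: p); rewrite ?andbF // !andbT.
apply: tails_regrow; rewrite eq /= lev_west depth_lev ?hd_interior //.
by move: (depth _ _) => d; lia.
Qed.

Lemma starts_regrow : starts G =1 starts F.
Proof.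
move=> v; have [iv|iv] := boolP (interior lam v); last by rewrite !startsE !card_no_hd.
pose A := grow b F (depth lam v).
have := grow_start_card (grow_card (depth_lev iv)).
rewrite -(cardsID [set p | (rank b A p < from west F v)%N]).
rewrite [X in (X + _)%N](_ : _ = from west F v); last first.
  rewrite -[RHS](grow_west_card (grow_card (depth_lev iv))); congr #|pred_of_set _|.
  apply/setP=> p; rewrite in_setI !in_set; case: (hd p == v); case: (p \in _) => //=.
  by apply: andb_idl => h; apply: ltn_addr.
move/addnI => <-; congr #|pred_of_set _|; apply/setP=> p; rewrite [LHS]in_set in_setD ![in RHS]in_set.
have [hp|_] := eqVneq (hd p) v; rewrite ?andbF // andbT -leqNgt.
by rewrite (@mem_regrow (depth lam v)) ?hp ?depth_lev // andbCA.
Qed.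

Lemma ends_regrow : ends G =1 ends F.
Proof.
move=> v; have [iv|iv] := boolP (interior lam v); last first.
  by apply/idP/idP => /ends_interior; rewrite (negPf iv).
have vs : is_segment lam [:: v] by rewrite is_segment_cons iv.
have lv := depth_lev iv; pose p := Segment vs.
have pv : vertices p = [:: v] by [].
have lp : lev (hd p) = (level_bound lam)%:Z - (depth lam v)%:Z by exact: lv.
rewrite -(tails_seg1 G pv) (tails_regrow lp).
have : (0 < depth lam v)%N by have := interior_lev iv; rewrite /depth; lia.
move: lp; case: (depth lam v) => // n lp _; clearbody p.
rewrite growS pv [hd _]/= in lp *; rewrite lp !eqxx andTb andTb.
case: (ends F v) => //; rewrite orFb.
by apply/negbTE/negP => /orP[]/exists_inP[q _ /andP[+ _]];
  rewrite eqseq_cons [vertices q]seg_cons andbF.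
Qed.

Lemma rank_lt (A : {set seg}) p q : p \in A -> seg_below b p q -> (rank b A p < rank b A q)%N.
Proof.
move=> pA pq; apply: proper_card; apply/properP; split.
  by apply/subsetP=> r; rewrite !in_set => /andP[-> rp]; apply: seg_below_trans pq.
by exists p; rewrite !in_set pA ?pq // seg_below_irr.
Qed.

(** In a clash the low path [p] comes from the north or starts, so its rank is at least
    [from west F v]; the high path [q] comes from the west or starts, so its rank is less than
    [from west F v + starts F v]. As [starts F v] is at most 1, [p] cannot rank strictly below
    [q]. *)
Lemma regrow_compatible : G \in compatible_family lam b.
Proof.
apply/compatible_familyP => s t sG tG st; apply/negP => /clashP.
move=> [s1 [s2 [t1 [t2 [u [es et u0 /andP[ws ls] /andP[nt lt]]]]]]].
case: u => // v u in es et u0 ws ls nt lt.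
have [q eq] : exists q : seg, vertices q = (v :: u) ++ s2.
  have h : is_segment lam ((v :: u) ++ s2).
    by apply: (@is_segment_catr lam s1) => //; rewrite -es; apply: segmentP.
  by exists (Segment h).
have [p ep] : exists p : seg, vertices p = (v :: u) ++ t2.
  have h : is_segment lam ((v :: u) ++ t2).
    by apply: (@is_segment_catr lam t1) => //; rewrite -et; apply: segmentP.
  by exists (Segment h).
rewrite -eq in es; rewrite -ep in et.
have hp : hd p = v by rewrite ep. have hq : hd q = v by rewrite eq.
have qT : q \in tails G by apply/tailsP; exists s => //; exists s1.
have pT : p \in tails G by apply/tailsP; exists t => //; exists t1.
have iv : interior lam v by rewrite -hp hd_interior.
pose n := depth lam v; have lv : lev v = (level_bound lam)%:Z - n%:Z := depth_lev iv.
pose A := grow b F n.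
have qA : q \in A by rewrite -(@tails_regrow n) ?hq.
have pA : p \in A by rewrite -(@tails_regrow n) ?hp.
have entered (d : point -> point) (r r' : seg) (r1 : seq point) : r \in G -> vertices r = r1 ++ r' -> hd r' = v ->
    (forall w, seg_step (d w) w) -> r1 != [::] -> enters d r1 (v :: u) ->
    [exists q in grow b F n.+1, vertices q == d (hd r') :: r'].
  case/lastP: r1 => // r1 w rG er hr dw _; rewrite /enters -size_eq0 size_rcons last_rcons /= => /eqP ew.
  have h : is_segment lam (w :: r').
    by apply: (@is_segment_catr lam r1) => //; rewrite -cat_rcons -er; apply: segmentP.
  apply/exists_inP; exists (Segment h); last by rewrite /= hr ew.
  rewrite -(@tails_regrow n.+1) /=; last first.
    by apply: level_pred lv _; rewrite ew; apply: lev_step.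
  by apply/tailsP; exists r => //; exists r1; rewrite /= -cat_rcons.
have Hq : s1 != [::] -> (rank b A q < from west F v)%N.
  move=> s0; rewrite -hq grow_west_next //; apply: (entered west s q s1) => //.
  by move=> w; rewrite seg_stepE eqxx.
have Hp : t1 != [::] -> (from west F v + starts F v <= rank b A p)%N.
  move=> t0; rewrite -hp grow_north_next //; apply: (entered north t p t1) => //.
  by move=> w; rewrite seg_stepE eqxx orbT.
have startG (r r' : seg) (r1 : seq point) : r \in G -> vertices r = r1 ++ r' -> r1 = [::] -> hd r' = v ->
    r = r' /\ (from west F v <= rank b A r' < from west F v + starts F v)%N.
  move=> rG er r0 hr; have rr : r = r' by apply: val_inj; rewrite /= er r0.
  by split=> //; move: rG; rewrite rr (@mem_regrow n) ?hr // => /andP[].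
have Hq' : (rank b A q < from west F v + starts F v)%N.
  case: (eqVneq s1 [::]) => [s0|/Hq /ltn_addr //].
  by have [_ /andP[]] := startG s q s1 sG es s0 hq.
have Hp' : (from west F v <= rank b A p)%N.
  case: (eqVneq t1 [::]) => [t0|/Hp]; last by apply: leq_trans; apply: leq_addr.
  by have [_ /andP[]] := startG t p t1 tG et t0 hp.
have := split_below lt ls; case/orP => [pq|/andP[/eqP t20 /eqP s20]].
  have : seg_below b p q by rewrite /seg_below hp hq eqxx ep eq.
  move/(rank_lt pA) => rpq.
  have := leq_trans Hq' (leq_add (leqnn (from west F v)) (starts_le1 v)).
  by rewrite addn1 ltnS leqNgt (leq_ltn_trans Hp' rpq).
(* Both paths stop with [u], hence coincide; their rank allows no preceding vertex, so [s] and [t]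
   are this same path. *)
have pq : p = q by apply: val_inj; rewrite /= ep eq t20 s20.
rewrite pq in Hp Hp'.
case: (eqVneq s1 [::]) => [s0|/Hq]; last by rewrite ltnNge Hp'.
case: (eqVneq t1 [::]) => [t0|/Hp]; last by rewrite leqNgt Hq'.
have [sq _] := startG s q s1 sG es s0 hq; have [tp _] := startG t p t1 tG et t0 hp.
by rewrite sq tp pq eqxx in st.
Qed.

End RegrowCorrect.

(** * The exchange of the two complexes and the weights it preserves *)

Section Exchange.
Variable lam : grid_shape.
Notation seg := (segment lam).
Implicit Types (F G : {set seg}) (p q s t : seg) (v w : point).

(** [regrow b' F] has the flow of [F], so rebuilding it for [b] gives what [F] itself gives, namely
    [F]. *)
Lemma regrowK b b' F : F \in compatible_family lam b -> regrow b (regrow b' F) = F.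
Proof.
move=> Fb; rewrite -[RHS](regrow_id Fb); apply: regrow_ext.
- exact: starts_regrow Fb.
- exact: ends_regrow Fb.
- exact: from_west_regrow Fb.
Qed.

Lemma compatible_sum b b' (V : nmodType) (wt : {set seg} -> V) :
  (forall F G, F \in compatible_family lam b -> G \in compatible_family lam b' ->
     starts F =1 starts G -> ends F =1 ends G -> through F =1 through G -> wt F = wt G) ->
  \sum_(F in compatible_family lam b) wt F = \sum_(F in compatible_family lam b') wt F.
Proof.
move=> wtE; have inj : {in compatible_family lam b &, injective (regrow b')}.
  by move=> F G Fb Gb FG; rewrite -(regrowK b' Fb) FG regrowK.
have <- : regrow b' @: compatible_family lam b = compatible_family lam b'.
  apply/setP=> G; apply/imsetP/idP => [[F Fb ->]|Gb]; first exact: regrow_compatible Fb.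
  by exists (regrow b G); [exact: regrow_compatible Gb | rewrite regrowK].
rewrite (big_imset _ inj); apply: eq_bigr => F Fb; apply: wtE.
- exact: Fb.
- exact: regrow_compatible Fb.
- by move=> v; rewrite (starts_regrow _ Fb).
- by move=> v; rewrite (ends_regrow _ Fb).
- by move=> v; rewrite (through_regrow _ Fb).
Qed.

Lemma card_starts F : #|F| = (\sum_(v <- enum_fset lam) starts F v)%N.
Proof.
rewrite -sum1_card; transitivity (\sum_(p in F) \sum_(v <- enum_fset lam) (hd p == v))%N.
  apply: eq_bigr => p _; rewrite -big_mkcond /= sum1_count.
  have -> : count [pred v | hd p == v] (enum_fset lam) = count_mem (hd p) (enum_fset lam).
    by apply: eq_count => v /=; rewrite eq_sym.
  rewrite count_uniq_mem ?fset_uniq //.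
  by have /andP[/andP[-> _] _] := hd_interior p.
rewrite exchange_big; apply: eq_bigr => v _ /=.
by rewrite /starts -sum1dep_card [RHS]big_mkcondr /=.
Qed.

Lemma lazy_segE s : lazy_seg s -> vertices s = [:: hd s].
Proof. by case: s => -[|v [|w s]]. Qed.

(** A lazy member is isolated exactly when it is the only passage through its vertex, which is
    visible in the flow. *)
Lemma epsE b F : F \in compatible_family lam b ->
  eps F = [set s : seg | [&& lazy_seg s, ends F (hd s), starts F (hd s) == 1%N &
                             through F (hd s) == 1%N]].
Proof.
move=> Fb; apply/setP=> s; rewrite [LHS]in_set [RHS]in_set.
apply/and3P/and4P => [[sF lz /forall_inP alone]|[lz es /eqP/mem_card1[p pE] /eqP/mem_card1[q qE]]].
  have es := lazy_segE lz.
  have only t : t \in F -> hd s \in vertices t -> t = s.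
    move=> tF st; apply/eqP/negPn/negP => ts.
    have := implyP (alone t tF) ts; rewrite es; apply/negP; rewrite negbK.
    by case/splitPr: st => u1 u2; apply/infixP; exists u1, u2.
  split=> //.
  - by apply/exists_inP; exists s; rewrite // es.
  - apply/eqP/(@eq_card1 _ s) => t; rewrite !inE; apply/andP/eqP => [[tF /eqP ht]|->]; last by rewrite sF.
    by apply: only; rewrite // -ht [vertices t]seg_cons mem_head.
  - apply/eqP/(@eq_card1 _ s) => t; rewrite !inE; apply/andP/eqP => [[/tailsP[r rF [r1 er]] /eqP ht]|->].
      have rs : r = s by apply: only; rewrite // er -ht mem_cat [vertices t]seg_cons mem_head orbT.
      apply: val_inj; move: er; rewrite /= rs es.
      case: r1 => [|x [|y r1]] //= [_]; by rewrite [vertices t]seg_cons.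
    by rewrite sub_tails.
have es' := lazy_segE lz.
have sq t : t \in tails F -> hd t = hd s -> t = q.
  by move=> tF ht; have := qE t; rewrite !inE tF ht eqxx => /esym/eqP.
have sT : s \in tails F by rewrite (tails_seg1 F es').
have pF : p \in F /\ hd p = hd s by have := pE p; rewrite !inE eqxx => /andP[-> /eqP->].
have sF : s \in F.
  by rewrite (sq s sT erefl) -(sq p (sub_tails pF.1) pF.2) pF.1.
split=> //; apply/forall_inP => t tF; apply/implyP => ts; apply/negP => /infixP[u1 [u2]].
rewrite es' => et; have : is_segment lam (hd s :: u2).
  by apply: (@is_segment_catr lam u1) => //; have := segmentP t; rewrite et.
move=> us; have [r er] : exists r : seg, vertices r = hd s :: u2 by exists (Segment us).
have rT : r \in tails F by apply/tailsP; exists t => //; exists u1; rewrite er.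
have rs : r = s by rewrite (sq r rT _) ?er // -(sq s sT erefl).
case/negP: ts; apply/eqP; apply: (ends_uniq Fb tF sF).
by rewrite -rs et last_cat er.
Qed.

Lemma compatible_eq_weight b b' F G : F \in compatible_family lam b -> G \in compatible_family lam b' ->
  starts F =1 starts G -> ends F =1 ends G -> through F =1 through G ->
  #|F| = #|G| /\ eps F = eps G.
Proof.
move=> Fb Gb h1 h2 h3; split.
  by rewrite !card_starts; apply: eq_bigr => v _; rewrite h1.
by rewrite (epsE Fb) (epsE Gb); apply/setP=> s; rewrite !inE h1 h2 h3.
Qed.

Lemma H_poly_crossing :
  H_poly lam = \sum_(F in compatible_family lam true) poly_x ^+ #|F| * poly_y ^+ #|eps F|.
Proof.
rewrite -(@compatible_sum false) => [|F G Fb Gb h1 h2 h3].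
  (* [friendly] unfolds to [clash false], so the two index sets agree by conversion. *)
  by [].
by have [-> ->] := compatible_eq_weight Fb Gb h1 h2 h3.
Qed.

End Exchange.

(** * Cells on either side of a segment *)

Section Filled.
Implicit Types (c d e o v w : point) (p q : seq point).
Variable lam : grid_shape.
Hypothesis corner : forall v : point, v \in lam -> south (east v) \in lam ->
  (south v \in lam) && (east v \in lam).

(** Only the NE-corner of [e] is missing; [corner] yields it from the NW-corner and the
    SE-corner. *)
Lemma has_cell_corner e : has_cell lam (west e) -> has_cell lam (south e) -> has_cell lam e.
Proof.
have -> : south e = (e.1, e.2 - 1) by [].
have -> : west e = (e.1 - 1, e.2) by [].
case: e => x y; rewrite /has_cell /east /north /= !subrK.
case/and4P=> _ e1 _ e3 /and4P[_ _ _ e4]; have := corner e3.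
by rewrite /south /east /= addrK => /(_ e4) /andP[_ ->]; rewrite e1 e4 e3.
Qed.

Definition diag_sum (v : point) : int := v.1 + v.2.

Lemma cell_stepP c d : cell_step c d ->
  [/\ c.1 <= d.1, c.2 <= d.2, d.1 <= c.1 + 1 & diag_sum d = diag_sum c + 1].
Proof. by rewrite /cell_step !point_eqE /diag_sum /= => h; split; lia. Qed.

Lemma chain_sum o p k : path cell_step o p -> (k <= size p)%N ->
  diag_sum (nth origin (o :: p) k) = diag_sum o + k%:Z.
Proof.
elim: p o k => [|c p IHp] o [|k] //=; rewrite ?addr0 //.
case/andP=> oc cp kp; rewrite -/(nth origin (c :: p) k) (IHp c k cp kp).
by have [_ _ _ ->] := cell_stepP oc; lia.
Qed.

Lemma chain_mono o p i j : path cell_step o p -> (i <= j)%N -> (j <= size p)%N ->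
  cell_le (nth origin (o :: p) i) (nth origin (o :: p) j).
Proof.
move=> op ij js; pose R := cell_le.
have Rr : reflexive R by move=> c; rewrite /R /cell_le !lexx.
have Rt : transitive R.
  by move=> c d e /andP[h1 h2] /andP[h3 h4]; apply/andP; split; [exact: le_trans h1 h3|exact: le_trans h2 h4].
have Rs : sorted R (o :: p).
  by apply: sub_path op => c d /cell_stepP[h1 h2 _ _]; apply/andP.
by apply: (sorted_leq_nth Rt Rr origin Rs) => //; rewrite inE /= ltnS ?(leq_trans ij).
Qed.

(** The region is filled one antidiagonal at a time: when [e] is on neither chain, its western and
    southern neighbours are again between the chains. *)
Lemma between_chains o p q k e : cell_chain lam o p -> cell_chain lam o q ->
  (k <= size p)%N -> (k <= size q)%N -> diag_sum e = diag_sum o + k%:Z ->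
  (nth origin (o :: p) k).1 <= e.1 -> e.1 <= (nth origin (o :: q) k).1 -> has_cell lam e.
Proof.
move=> /andP[/allP pc pp] /andP[/allP qc qp]; elim: k e => [|k IHk] e kp kq es.
  move=> /= pe eq; have -> : e = o; last by apply: pc; rewrite mem_head.
  by rewrite /diag_sum in es; apply/eqP; rewrite point_eqE; lia.
move=> pe eq.
have Np : nth origin (o :: p) k.+1 \in o :: p by apply: mem_nth.
have Nq : nth origin (o :: q) k.+1 \in o :: q by apply: mem_nth.
have sp := chain_sum pp kp; have sq := chain_sum qp kq.
have sp' := chain_sum pp (ltnW kp); have sq' := chain_sum qp (ltnW kq).
have [/andP[mp1 mp2] /andP[mq1 mq2]] := (chain_mono pp (leqnSn k) kp, chain_mono qp (leqnSn k) kq).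
move: Np Nq sp sq sp' sq' mp1 mp2 mq1 mq2 pe eq
  (IHk (west e) (ltnW kp) (ltnW kq)) (IHk (south e) (ltnW kp) (ltnW kq)).
move: (nth origin (o :: p) k.+1) (nth origin (o :: q) k.+1) (nth origin (o :: p) k) (nth origin (o :: q) k).
move=> P' Q' P Q Np Nq sp sq sp' sq' mp1 mp2 mq1 mq2 pe eq Hw Hs.
have [ep|np] := eqVneq e P'; first by rewrite ep; apply: pc.
have [ep|nq] := eqVneq e Q'; first by rewrite ep; apply: qc.
rewrite /diag_sum /= in es sp sq sp' sq' Hw Hs.
rewrite !point_eqE in np nq.
by apply: has_cell_corner; [apply: Hw|apply: Hs]; rewrite /=; lia.
Qed.

Hypothesis chains : forall c d : point, has_cell lam c -> has_cell lam d ->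
     exists (o : point) (p q : seq point),
       [/\ cell_chain lam o p && cell_chain lam o q,
           size p = size q, last o p = last o q, c \in o :: p & d \in o :: q].

(** Chains are monotone, so on the antidiagonal of [e] the chain through [c] is weakly to the west
    of [e] and the chain through [d] weakly to the east. *)
Lemma has_cell_rectangle c d e : has_cell lam c -> has_cell lam d ->
  c.1 <= e.1 -> e.1 <= d.1 -> d.2 <= e.2 -> e.2 <= c.2 -> has_cell lam e.
Proof.
move=> cl dl ce ed de ec.
have [o [p [q [/andP[op oq] spq lpq cp dq]]]] := chains cl dl.
have [/andP[_ pp] /andP[_ qp]] := (op, oq).
have [i ip ci] := nthP origin cp; have [j jq dj] := nthP origin dq.
rewrite /= ltnS in ip; rewrite /= ltnS in jq.
have /andP[oc1 oc2] := chain_mono pp (leq0n i) ip.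
have /andP[od1 od2] := chain_mono qp (leq0n j) jq.
have /andP[cl1 cl2] := chain_mono pp ip (leqnn _).
have /andP[dl1 dl2] := chain_mono qp jq (leqnn _).
have sl := chain_sum pp (leqnn _).
have eL : nth origin (o :: q) (size q) = nth origin (o :: p) (size p).
  by rewrite !(nth_last _ (_ :: _)) /= lpq.
rewrite dj eL in dl1 dl2; rewrite ci /= in cl1 cl2 oc1 oc2; rewrite dj /= in od1 od2.
have [k ek kp] : exists2 k : nat, diag_sum e = diag_sum o + k%:Z & (k <= size p)%N.
  exists `|(diag_sum e - diag_sum o)%R|%N.
    have h1 : o.1 <= e.1 by exact: le_trans oc1 ce.
    have h2 : o.2 <= e.2 by exact: le_trans od2 de.
    by move: h1 h2; rewrite /diag_sum; lia.
  by move: sl cl1 cl2 dl1 dl2; move: (nth _ _ _) => L; rewrite /diag_sum; lia.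
have kq : (k <= size q)%N by rewrite -spq.
have sp := chain_sum pp kp; have sq := chain_sum qp kq.
apply: (between_chains op oq kp kq ek).
  have [ik|ki] := leqP i k.
    have /andP[] := chain_mono pp ik kp; rewrite ci; move: sp ek.
    by rewrite /diag_sum; move: (nth _ _ _) => L; lia.
  have /andP[] := chain_mono pp (ltnW ki) ip; rewrite ci.
  by move: (nth _ _ _) => L; lia.
have [ik|ki] := leqP j k.
  have /andP[] := chain_mono qp ik kq; rewrite dj.
  by move: (nth _ _ _) => L; lia.
have /andP[] := chain_mono qp (ltnW ki) jq; rewrite dj; move: sq ek.
by rewrite /diag_sum; move: (nth _ _ _) => L; lia.
Qed.

End Filled.

(** * The ideal and the filter separated by a segment *)

Section Arcs.
Variable lam : grid_shape.
Notation seg := (segment lam).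
Implicit Types (s t p : seg) (v w a c d e : point).

(* The cells that touch the ends of s, and the cells that lie on the two sides
   of every ideal of cells whose boundary contains s. *)
Definition nw_cell s : point := west (hd s).
Definition se_cell s : point := south (last origin s).
Definition ideal_side s : pred point :=
  fun e => has (cell_le e) (se_cell s :: [seq west (south v) | v <- vertices s]).
Definition filter_side s : pred point :=
  fun e => has (fun g => cell_le g e) (nw_cell s :: vertices s).

(** The column-by-column order against which inversions are taken; it is a linear extension of
    [cell_le]. *)
Definition lex_lt c d : bool := (c.1 < d.1) || (c.1 == d.1) && (c.2 < d.2).
Definition lex_le c d : bool := (c == d) || lex_lt c d.

Lemma cell_le_trans : transitive cell_le.
Proof.
move=> d c e /andP[h1 h2] /andP[h3 h4].
by apply/andP; split; [exact: le_trans h1 h3|exact: le_trans h2 h4].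
Qed.

Lemma ideal_side_le s d e : cell_le d e -> ideal_side s e -> ideal_side s d.
Proof. by move=> de /hasP[g gs eg]; apply/hasP; exists g => //; apply: cell_le_trans eg. Qed.

Lemma filter_side_ge s d e : cell_le d e -> filter_side s d -> filter_side s e.
Proof. by move=> de /hasP[g gs gd]; apply/hasP; exists g => //; apply: cell_le_trans de. Qed.

Lemma seg_antitone s v w : v \in vertices s -> w \in vertices s ->
  (v.1 <= w.1) && (w.2 <= v.2) || (w.1 <= v.1) && (v.2 <= w.2).
Proof.
move=> vs ws; pose R v w := (v.1 <= w.1) && (w.2 <= v.2).
have Rr : reflexive R by move=> c; rewrite /R !lexx.
have Rt : transitive R.
  by move=> x y z /andP[h1 h2] /andP[h3 h4]; rewrite /R (le_trans h1 h3) (le_trans h4 h2).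
have Rs : sorted R (vertices s).
  have /and3P[_ _] := segmentP s; apply: sub_sorted => x y.
  by rewrite /seg_step /R !point_eqE /=; lia.
have [i il <-] := nthP origin vs; have [j jl <-] := nthP origin ws.
by case: (leqP i j) => [ij|/ltnW ji];
  [have := sorted_leq_nth Rt Rr origin Rs i j il jl ij | have := sorted_leq_nth Rt Rr origin Rs j i jl il ji];
  rewrite /R => ->; rewrite ?orbT.
Qed.

Lemma last_mem s : last origin s \in vertices s.
Proof. by case: s => -[|v s] //= _; apply: mem_last. Qed.

Lemma hd_last_extreme s v : v \in vertices s ->
  [/\ (hd s).1 <= v.1, v.2 <= (hd s).2, v.1 <= (last origin s).1 & (last origin s).2 <= v.2].
Proof.
case: s => -[|x s] //= /and3P[_ _ /= xs].
pose R (v w : point) := (v.1 <= w.1) && (w.2 <= v.2).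
have Rt : transitive R.
  by move=> a b c /andP[h1 h2] /andP[h3 h4]; rewrite /R (le_trans h1 h3) (le_trans h4 h2).
have Rs : path R x s.
  by apply: sub_path xs => a b; rewrite /seg_step /R !point_eqE /=; lia.
move=> vs; suff /andP[/andP[-> ->] /andP[-> ->]] : R x v && R v (last x s) by [].
apply/andP; split.
  move: vs; rewrite inE => /orP[/eqP->|]; first by rewrite /R !lexx.
  by have /allP := order_path_min Rt Rs; apply.
elim: s x v Rs vs {xs} => [|y s IHs] x v /=; first by rewrite inE => _ /eqP->; rewrite /R !lexx.
move=> /andP[xy ys]; rewrite inE => /orP[/eqP->|]; last exact: IHs.
by apply: Rt xy _; apply: IHs; rewrite ?mem_head.
Qed.

(** Along a segment the abscissa grows while the ordinate shrinks, so no generator of the filter is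
    below a generator of the ideal. *)
Lemma sides_disjoint s e : ideal_side s e -> filter_side s e -> False.
Proof.
have hl := hd_last_extreme (last_mem s).
case/hasP=> g gi eg /hasP[f ff fe]; have := cell_le_trans fe eg.
move: gi ff; rewrite !inE => /orP[/eqP->|/mapP[v vs ->]] /orP[/eqP->|ws];
  rewrite /cell_le /se_cell /nw_cell /=.
- by case: hl; move: (hd s) (last origin s) => h l /=; lia.
- by case: (hd_last_extreme ws); move: (hd s) (last origin s) => h l /=; lia.
- by case: (hd_last_extreme vs); move: (hd s) (last origin s) => h l /=; lia.
- by have := seg_antitone vs ws; lia.
Qed.

Lemma ideal_side_lex s e : ideal_side s e -> lex_le e (se_cell s).
Proof.
case/hasP=> g; rewrite inE => /orP[/eqP->|/mapP[v vs ->]]; rewrite /cell_le /lex_le /lex_lt !point_eqE /=.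
  by lia.
by have [] := hd_last_extreme vs; rewrite /se_cell /=; lia.
Qed.

Lemma filter_side_lex s e : filter_side s e -> lex_le (nw_cell s) e.
Proof.
case/hasP=> g; rewrite inE => /orP[/eqP->|vs]; rewrite /cell_le /lex_le /lex_lt !point_eqE /=.
  by lia.
by have [] := hd_last_extreme vs; rewrite /nw_cell /=; lia.
Qed.

(** A cell of an intermediate column is above or below the eastward step of [s] across that column;
    the two end cells settle the first and the last column. *)
Lemma sides_cover s e : lex_le (nw_cell s) e -> lex_le e (se_cell s) ->
  ideal_side s e || filter_side s e.
Proof.
have key v (p : seq point) : path seg_step v p -> v.1 <= e.1 -> e.1 < (last v p).1 ->
    has (cell_le e) [seq west (south w) | w <- v :: p] || has (fun g => cell_le g e) (v :: p).
  elim: p v => [|w p IHp] v /=; first by lia.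
  case/andP=> vw wp ve el.
  have [we|we] := leP w.1 e.1.
    by have := IHp w wp we el => /= /orP[]->; rewrite !orbT.
  move: vw we; rewrite /seg_step !point_eqE /= => h we.
  have [ev|ev] := leP v.2 e.2.
    by apply/orP; right; apply/orP; left; rewrite /cell_le; lia.
  by apply/orP; left; apply/orP; right; apply/orP; left; rewrite /cell_le /=; lia.
rewrite /ideal_side /filter_side /= => ce ed.
have [e0|e0] := boolP (cell_le e (se_cell s)) => //=.
have [e1|e1] := boolP (cell_le (nw_cell s) e) => /=; first by rewrite orbT.
have := key (hd s) (behead s) (seg_path s); rewrite -seg_cons.
have -> : last (hd s) (behead s) = last origin s by case: (s) => -[|v p].
have := hd_last_extreme (last_mem s).
move: e0 e1 ce ed; rewrite /cell_le /lex_le /lex_lt /nw_cell /se_cell !point_eqE /=.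
by move=> e0 e1 ce ed [h1 h2 h3 h4]; apply; lia.
Qed.

Lemma sides_separated s b a : ideal_side s b -> filter_side s a -> ~~ cell_le a b.
Proof.
move=> bi af; apply/negP => ab; apply: (@sides_disjoint s b) => //.
exact: filter_side_ge ab af.
Qed.

Lemma se_cell_ideal s : ideal_side s (se_cell s).
Proof. by rewrite /ideal_side /= /cell_le !lexx. Qed.
Lemma nw_cell_filter s : filter_side s (nw_cell s).
Proof. by rewrite /filter_side /= /cell_le !lexx. Qed.
Lemma sw_ideal s v : v \in vertices s -> ideal_side s (west (south v)).
Proof.
move=> vs; apply/hasP; exists (west (south v)); last by rewrite /cell_le !lexx.
by rewrite in_cons; apply/orP; right; apply/mapP; exists v.
Qed.
Lemma ne_filter s v : v \in vertices s -> filter_side s v.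
Proof. by move=> vs; apply/hasP; exists v; rewrite /cell_le ?lexx // in_cons vs orbT. Qed.

Lemma lex_strictly_NW a b : lex_lt a b -> ~~ cell_le a b -> strictly_NW a b.
Proof. by rewrite /lex_lt /cell_le /strictly_NW; lia. Qed.

End Arcs.

(** * Geometric crossings are clashes *)

Section Crossing.
Variable lam : grid_shape.
Notation seg := (segment lam).
Implicit Types (s t p : seg) (v w a c d e : point) (k : int).

(** A discrete intermediate value argument: [j] is the first negative index and [i] the last
    positive index before it. As [f] loses at most 1 per step, zeros lie in between. *)
Lemma first_descent_to_negative (f : nat -> int) m : 0 < f 0%N -> f m < 0 ->
  (forall i, f i - 1 <= f i.+1) ->
  exists i j : nat, [/\ (i.+1 < j)%N, (j <= m)%N, f i = 1, f j = -1 &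
    forall l : nat, (i < l)%N -> (l < j)%N -> f l = 0].
Proof.
move=> f0 fm step; have exj : exists j, f j < 0 by exists m.
pose j := ex_minn exj; have [fj minj] : f j < 0 /\ (forall l, f l < 0 -> (j <= l)%N).
  by rewrite /j; case: ex_minnP.
have exi : exists i, (i <= j)%N && (0 < f i) by exists 0%N.
have bi i : (i <= j)%N && (0 < f i) -> (i <= j)%N by case/andP.
pose i := ex_maxn exi bi.
have [/andP[ij fi] maxi] : (i <= j)%N && (0 < f i) /\
    (forall l, (l <= j)%N && (0 < f l) -> (l <= i)%N).
  by rewrite /i; case: ex_maxnP.
clearbody i j; exists i, j.
have ij' : (i < j)%N by rewrite ltn_neqAle ij andbT; apply: contraTneq fi => ->; lia.
have zero l : (i < l)%N -> (l < j)%N -> f l = 0.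
  move=> il lj; have h1 := maxi l; have h2 := minj l.
  by have [h|h|//] := ltgtP (f l) 0; [have := h2 h|move: h1; rewrite h ltnW // => /(_ isT)]; lia.
have i1j : (i.+1 < j)%N.
  rewrite ltn_neqAle ij' andbT; apply/eqP => e; have := step i.
  by rewrite e; lia.
split=> //.
- exact: minj.
- by have := step i; have := zero i.+1 (ltnSn i) i1j; lia.
- have := step j.-1; rewrite prednK; last by lia.
  by have := zero j.-1; lia.
Qed.

Definition vertex_at s k : point := nth origin s `|(k - lev (hd s))%R|.

(* The abscissa of s at level k, where s is prolonged to the west and to the
   east if o holds, and to the north and to the south otherwise. *)
Definition abscissa (o : bool) s k : int :=
  if k < lev (hd s) then (hd s).1 + (if o then k - lev (hd s) else 0)
  else if lev (last origin s) < k then (last origin s).1 + (if o then k - lev (last origin s) else 0)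
  else (vertex_at s k).1.

Lemma index_lt s k : lev (hd s) <= k -> k <= lev (last origin s) ->
  (`|(k - lev (hd s))%R| < size s)%N.
Proof.
rewrite (lev_last s) (_ : size s = (size (behead s)).+1); last first.
  by rewrite [in LHS]seg_cons.
move: (lev (hd s)) (size (behead s)) => l m /=; lia.
Qed.

Lemma vertex_at_mem s k : lev (hd s) <= k -> k <= lev (last origin s) ->
  vertex_at s k \in vertices s.
Proof. by move=> h1 h2; apply: mem_nth; apply: index_lt. Qed.

Lemma lev_vertex_at s k : lev (hd s) <= k -> k <= lev (last origin s) ->
  lev (vertex_at s k) = k.
Proof.
move=> h1 h2; have := index_lt h1 h2; rewrite /vertex_at [in size _]seg_cons ltnS.
move=> il; rewrite [in nth _ _ _]seg_cons (lev_path (seg_path s) il).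
by move: (lev (hd s)) h1 => l; lia.
Qed.

Lemma vertex_at_hd s : vertex_at s (lev (hd s)) = hd s.
Proof. by rewrite /vertex_at subrr nth0. Qed.

Lemma vertex_at_last s : vertex_at s (lev (last origin s)) = last origin s.
Proof.
rewrite /vertex_at -[RHS]nth_last; congr (nth _ _ _).
by rewrite lev_last addrAC subrr add0r.
Qed.

Lemma lev_hd_last s : lev (hd s) <= lev (last origin s).
Proof. by rewrite lev_last lerDl. Qed.

Lemma vertex_at_step s k : lev (hd s) <= k -> k < lev (last origin s) ->
  seg_step (vertex_at s k) (vertex_at s (k + 1)).
Proof.
move=> h1 h2; rewrite /vertex_at.
have -> : `|(k + 1 - lev (hd s))%R|%N = `|(k - lev (hd s))%R|.+1.
  by move: (lev (hd s)) h1 => l; lia.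
have : (`|(k - lev (hd s))%R|.+1 < size s)%N.
  have := @index_lt s (k + 1); rewrite (_ : `|(k + 1 - lev (hd s))%R|%N = `|(k - lev (hd s))%R|.+1).
    by apply; move: (lev (hd s)) (lev (last origin s)) h1 h2 => l m; lia.
  by move: (lev (hd s)) h1 => l; lia.
move: `|_|%N => i; case: (s) => -[|v p] //= /and3P[_ _ vp] ip.
by have /pathP := vp; apply.
Qed.

Lemma abscissa_hd o s k : k <= lev (hd s) ->
  abscissa o s k = (hd s).1 + (if o then k - lev (hd s) else 0).
Proof.
rewrite le_eqVlt /abscissa => /orP[/eqP->|-> //].
by rewrite ltxx ltNge lev_hd_last vertex_at_hd subrr /=; case: o; rewrite addr0.
Qed.

Lemma abscissa_last o s k : lev (last origin s) <= k ->
  abscissa o s k = (last origin s).1 + (if o then k - lev (last origin s) else 0).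
Proof.
rewrite le_eqVlt /abscissa => /orP[/eqP<-|h].
  by rewrite ltxx ltNge lev_hd_last vertex_at_last subrr /=; case: o; rewrite addr0.
by rewrite h ltNge (le_trans (lev_hd_last s) (ltW h)).
Qed.

Lemma abscissa_mid o s k : lev (hd s) <= k -> k <= lev (last origin s) ->
  abscissa o s k = (vertex_at s k).1.
Proof. by move=> h1 h2; rewrite /abscissa !ltNge h1 h2. Qed.

Lemma abscissa_step o s k :
  abscissa o s k <= abscissa o s (k + 1) /\ abscissa o s (k + 1) <= abscissa o s k + 1.
Proof.
have [h1|h1] := ltP k (lev (hd s)).
  have h1' : k + 1 <= lev (hd s) by rewrite lezD1.
  rewrite (abscissa_hd o (ltW h1)) (abscissa_hd o h1').
  by case: o; move: (lev (hd s)) (hd s).1 h1 {h1'} => l x h; lia.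
have [h2|h2] := leP (lev (last origin s)) k.
  have h2' : lev (last origin s) <= k + 1 by rewrite (le_trans h2) ?lerDl.
  rewrite (abscissa_last o h2) (abscissa_last o h2').
  by case: o; move: (lev (last origin s)) (last origin s).1 h2 {h2'} => l x h; lia.
have h1' : lev (hd s) <= k + 1 by rewrite (le_trans h1) ?lerDl.
have h2' : k + 1 <= lev (last origin s) by rewrite lezD1.
rewrite (abscissa_mid o h1 (ltW h2)) (abscissa_mid o h1' h2').
have := vertex_at_step h1 h2; move: (vertex_at s k) (vertex_at s (k + 1)) => v w.
by rewrite /seg_step !point_eqE /=; lia.
Qed.

Lemma lev_eq v w : lev v = lev w -> v.1 = w.1 -> v = w.
Proof. by rewrite /lev => h1 h2; apply/eqP; rewrite point_eqE; lia. Qed.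

Lemma absz_sub_le (l m n : int) : l <= m -> m <= n -> (`|(m - l)%R| <= `|(n - l)%R|)%N.
Proof. lia. Qed.

Lemma absz_len (A B k l : int) : l <= A -> k <= A -> A <= B ->
  (`|(B - l)%R|.+1 - `|(A - l)%R| = `|(B - k)%R|.+1 - `|(A - k)%R|)%N.
Proof. lia. Qed.

Lemma nth_vertex_at s k i : lev (hd s) + i%:Z = k -> nth origin s i = vertex_at s k.
Proof. by move=> <-; rewrite /vertex_at addrAC subrr add0r. Qed.

Lemma absz_pos (l m : int) : l <= m -> l + `|(m - l)%R|%:Z = m.
Proof. lia. Qed.

(** The zeros of the difference of abscissas form the common stretch; the values 1 before it and -1
    after it fix the entries and exits. Each segment is prolonged in the directions of its role in
    the clash, so that starting and ending obey the same equations; the bounds on [p] and [q] keep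
    the common stretch inside both segments. *)
Lemma clash_of_crossing s t (p q : int) : p < q ->
  lev (hd s) - 1 <= p -> lev (hd t) - 1 <= p ->
  q <= lev (last origin s) + 1 -> q <= lev (last origin t) + 1 ->
  abscissa true t p < abscissa false s p -> abscissa false s q < abscissa true t q ->
  clash true t s.
Proof.
move=> pq ps pt qs qt fp fq.
pose f (i : nat) := abscissa false s (p + i%:Z) - abscissa true t (p + i%:Z).
have fstep i : f i - 1 <= f i.+1.
  rewrite /f (_ : p + i.+1%:Z = p + i%:Z + 1); last by lia.
  have := abscissa_step false s (p + i%:Z); have := abscissa_step true t (p + i%:Z).
  move: (abscissa _ _ _) (abscissa _ _ _) (abscissa _ _ _) (abscissa _ _ _) => x y z w; lia.
have [||i [j [ij jm fi fj fz]]] := @first_descent_to_negative f `|(q - p)%R| _ _ fstep.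
- by rewrite /f addr0 subr_gt0.
- by rewrite /f (_ : p + `|(q - p)%R|%N%:Z = q) ?subr_lt0 //; lia.
have jq : p + j%:Z <= q by lia.
pose A : int := p + i%:Z + 1; pose B : int := p + j%:Z - 1.
have AB : A <= B by rewrite /A /B; lia.
have sA : lev (hd s) <= A by move: ps; rewrite /A; move: (lev _) => l; lia.
have tA : lev (hd t) <= A by move: pt; rewrite /A; move: (lev _) => l; lia.
have sB : B <= lev (last origin s) by move: qs jq; rewrite /B; move: (lev _) => l; lia.
have tB : B <= lev (last origin t) by move: qt jq; rewrite /B; move: (lev _) => l; lia.
have eqv k : A <= k -> k <= B -> vertex_at s k = vertex_at t k.
  move=> Ak kB; have := fz `|(k - p)%R|%N; rewrite /f.
  have -> : p + `|(k - p)%R|%N%:Z = k by move: Ak; rewrite /A; lia.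
  rewrite !abscissa_mid ?(le_trans _ Ak) ?(le_trans kB) // => h.
  apply: lev_eq; first by rewrite !lev_vertex_at ?(le_trans _ Ak) ?(le_trans kB).
  by apply/eqP; rewrite -subr_eq0 h //; move: Ak kB; rewrite /A /B; lia.
pose si := `|(A - lev (hd s))%R|%N; pose sj := `|(B - lev (hd s))%R|%N.
pose ti := `|(A - lev (hd t))%R|%N; pose tj := `|(B - lev (hd t))%R|%N.
have sil : (si < size s)%N by apply: index_lt => //; apply: le_trans AB sB.
have sjl : (sj < size s)%N by apply: index_lt => //; apply: le_trans sA AB.
have til : (ti < size t)%N by apply: index_lt => //; apply: le_trans AB tB.
have tjl : (tj < size t)%N by apply: index_lt => //; apply: le_trans tA AB.
have sij : (si <= sj)%N := absz_sub_le sA AB.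
have tij : (ti <= tj)%N := absz_sub_le tA AB.
have fA : abscissa false s (A - 1) = abscissa true t (A - 1) + 1.
  by move: fi; rewrite /f (_ : A - 1 = p + i%:Z); [lia|rewrite /A; lia].
have fB : abscissa false s (B + 1) = abscissa true t (B + 1) - 1.
  by move: fj; rewrite /f (_ : B + 1 = p + j%:Z); [lia|rewrite /B; lia].
have eA := eqv A (lexx A) AB; have eB := eqv B AB (lexx B).
have sB' := le_trans AB sB; have tB' := le_trans AB tB.
have sA' := le_trans sA AB; have tA' := le_trans tA AB.
(* An abscissa grows by 0 or 1 per level, so a difference of 1 that vanishes at [A] means that [t]
   steps east and [s] steps south. *)
have [xsA xtA] : abscissa false s (A - 1) = (vertex_at t A).1 /\
    abscissa true t (A - 1) = (vertex_at t A).1 - 1.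
  have := abscissa_step false s (A - 1); have := abscissa_step true t (A - 1).
  rewrite !subrK (abscissa_mid _ sA sB') (abscissa_mid _ tA tB') eA fA.
  by move: (abscissa _ _ _) (vertex_at t A).1 => x y; lia.
have [xsB xtB] : abscissa false s (B + 1) = (vertex_at t B).1 /\
    abscissa true t (B + 1) = (vertex_at t B).1 + 1.
  have := abscissa_step false s B; have := abscissa_step true t B.
  rewrite (abscissa_mid _ sA' sB) (abscissa_mid _ tA' tB) eB fB.
  by move: (abscissa _ _ _) (vertex_at t B).1 => x y; lia.
have levA := lev_vertex_at tA tB'; have levB := lev_vertex_at tA' tB.
clear fi fj fz fA fB fstep f fp fq ps pt qs qt jq ij jm.
clearbody A B; clear i j.
have Es : nth origin s si = vertex_at t A by rewrite -eA.
have Et : nth origin t ti = vertex_at t A by [].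
have Fs : nth origin s sj = vertex_at t B by rewrite -eB.
have Ft : nth origin t tj = vertex_at t B by [].
have before (r : seg) o (d : point -> point) (i : nat) : i = `|(A - lev (hd r))%R|%N ->
    lev (hd r) <= A -> A <= lev (last origin r) -> nth origin r i = vertex_at t A ->
    abscissa o r (A - 1) = (d (vertex_at t A)).1 -> (forall v, lev (d v) = lev v - 1) ->
    starts_or_enters d r i.
  move=> ei rA rA' En ex dl; rewrite /starts_or_enters; case: eqP => //= /eqP i0.
  have r1 : lev (hd r) <= A - 1 by move: i0 rA; rewrite ei; move: (lev _) => l; lia.
  rewrite (@nth_vertex_at r (A - 1)); last first.
    by move: i0 rA; rewrite ei; move: (lev _) => l; lia.
  have r2 : A - 1 <= lev (last origin r) by apply: le_trans rA'; rewrite gerBl.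
  apply/eqP/lev_eq; first by rewrite En dl levA lev_vertex_at.
  by rewrite -(abscissa_mid o r1 r2) ex En.
have after (r : seg) o (d : point -> point) (i : nat) : i = `|(B - lev (hd r))%R|%N ->
    lev (hd r) <= B -> B <= lev (last origin r) -> nth origin r i = vertex_at t B ->
    abscissa o r (B + 1) = (d (vertex_at t B)).1 -> (forall v, lev (d v) = lev v + 1) ->
    ends_or_leaves d r i.
  move=> ei rB rB' En ex dl; rewrite /ends_or_leaves; case: eqP => //= i0.
  have il : lev (last origin r) = B -> i.+1 = size r.
    rewrite ei lev_last => <-; rewrite addrAC subrr add0r /= prednK //.
    by rewrite [in size r]seg_cons.
  have r2 : B + 1 <= lev (last origin r).
    rewrite lezD1 lt_neqAle rB' andbT; apply/eqP => e; exact/i0/il.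
  have r1 : lev (hd r) <= B + 1 by rewrite (le_trans rB) ?lerDl.
  rewrite (@nth_vertex_at r (B + 1)); last first.
    by move: rB; rewrite ei; move: (lev _) => l; lia.
  apply/eqP/lev_eq; first by rewrite En dl levB lev_vertex_at.
  by rewrite -(abscissa_mid o r1 r2) ex En.
have sub_eq : subseg t ti tj = subseg s si sj.
  have size_sub (r : seq point) (i k : nat) : (i <= k)%N -> (k < size r)%N -> size (subseg r i k) = (k.+1 - i)%N.
    by move=> ik kr; rewrite /subseg size_takel // size_drop leq_sub2r.
  have nth_sub (r : seq point) (i k l : nat) : (l < k.+1 - i)%N -> nth origin (subseg r i k) l = nth origin r (i + l).
    by move=> lk; rewrite /subseg nth_take // nth_drop.
  have len : (tj.+1 - ti = sj.+1 - si)%N.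
    by apply: absz_len.
  apply: (@eq_from_nth _ origin) => [|l]; first by rewrite !size_sub.
  rewrite size_sub // => ll; rewrite !nth_sub -?len //.
  have lB : A + l%:Z <= B.
    by move: ll; rewrite /ti /tj; move: tA tA'; move: (lev _) => m; lia.
  rewrite (@nth_vertex_at t (A + l%:Z)) ?(@nth_vertex_at s (A + l%:Z)).
  - by rewrite eqv // lerDl.
  - by rewrite PoszD addrA absz_pos.
  - by rewrite PoszD addrA absz_pos.
apply/existsP; exists (Ordinal til); apply/existsP; exists (Ordinal tjl).
apply/existsP; exists (Ordinal sil); apply/existsP; exists (Ordinal sjl).
rewrite /= tij sij sub_eq eqxx /=; apply/and4P; split.
- by apply: (before t true) => //; apply: lev_west.
- by apply: (after t true) => // v; rewrite /lev /=; lia.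
- by apply: (before s false) => //; apply: lev_north.
- by apply: (after s false) => // v; rewrite /lev /=; lia.
Qed.

Lemma abscissa_mono o s k l : k <= l -> abscissa o s k <= abscissa o s l.
Proof.
move=> kl; have -> : l = k + `|(l - k)%R|%:Z by lia.
elim: `|_|%N => [|n IHn]; first by rewrite addr0.
by rewrite -addn1 PoszD addrA; apply: le_trans IHn _; have [] := abscissa_step o s (k + n%:Z).
Qed.

Lemma filter_side_vertex s k e : lev e = k -> lev (hd s) <= k -> k <= lev (last origin s) ->
  filter_side s e -> (vertex_at s k).1 <= e.1.
Proof.
move=> ek h1 h2 fe; rewrite leNgt; apply/negP => ev; apply: (sides_disjoint (e := e)) fe.
apply: (ideal_side_le _ (sw_ideal (vertex_at_mem h1 h2))).
by move: ek (lev_vertex_at h1 h2) ev; move: (vertex_at s k) => v; rewrite /lev /cell_le /=; lia.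
Qed.

Lemma ideal_side_vertex s k e : lev e = k -> lev (hd s) <= k -> k <= lev (last origin s) ->
  ideal_side s e -> e.1 < (vertex_at s k).1.
Proof.
move=> ek h1 h2 ie; rewrite ltNge; apply/negP => ev; apply: (sides_disjoint ie).
apply: (filter_side_ge _ (ne_filter (vertex_at_mem h1 h2))).
by move: ek (lev_vertex_at h1 h2) ev; move: (vertex_at s k) => v; rewrite /lev /cell_le /=; lia.
Qed.

Lemma filter_side_high s e : filter_side s e -> (last origin s).2 <= e.2.
Proof.
have [_ h _ _] := hd_last_extreme (last_mem s).
case/hasP=> g; rewrite in_cons => /orP[/eqP->|gs] /andP[_]; first exact: le_trans.
by have [_ _ _ h'] := hd_last_extreme gs; apply: le_trans.
Qed.

Lemma ideal_side_low s e : ideal_side s e -> e.2 < (hd s).2.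
Proof.
have [_ h _ _] := hd_last_extreme (last_mem s).
case/hasP=> g; rewrite in_cons => /orP[/eqP->|/mapP[v vs ->]] /andP[_ /le_lt_trans]; apply.
  by apply: lt_le_trans h; rewrite gtrBl.
by have [_ h' _ _] := hd_last_extreme vs; apply: lt_le_trans h'; rewrite gtrBl.
Qed.

(** At the level of [a], [s] passes strictly to the east of [a] and [t] does not; at the level of
    [b] the roles are exchanged. So [s] and [t] change sides in between. *)
Lemma crossing_clash s t a b :
  lex_lt a b -> lex_le (nw_cell s) a -> lex_le b (se_cell s) ->
  filter_side t a -> ideal_side t b ->
  ideal_side s a || (a == nw_cell s) -> filter_side s b || (b == se_cell s) ->
  clash true t s.
Proof.
move=> ab sa bs ta tb ia fb.
have /andP[ab1 ab2] := lex_strictly_NW ab (sides_separated tb ta).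
have as1 : (hd s).1 - 1 <= a.1.
  by move: sa; rewrite /lex_le /lex_lt /nw_cell point_eqE /=; clear; lia.
have bs1 : b.1 <= (last origin s).1.
  by move: bs; rewrite /lex_le /lex_lt /se_cell point_eqE /=; clear; lia.
have at1 : (hd t).1 - 1 <= a.1.
  by have := filter_side_lex ta; rewrite /lex_le /lex_lt /nw_cell point_eqE /=; clear; lia.
have bt1 : b.1 <= (last origin t).1.
  by have := ideal_side_lex tb; rewrite /lex_le /lex_lt /se_cell point_eqE /=; clear; lia.
have at2 := filter_side_high ta; have bt2 := ideal_side_low tb.
have low_s : lev (hd s) <= lev a \/ a = nw_cell s.
  case/orP: ia => [/ideal_side_low h|/eqP]; last by right.
  by left; move: as1 h; rewrite /lev; clear; lia.
have high_s : lev b <= lev (last origin s) \/ b = se_cell s.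
  case/orP: fb => [/filter_side_high h|/eqP]; last by right.
  by left; move: bs1 h; rewrite /lev; clear; lia.
have sx_a : a.1 < abscissa false s (lev a).
  have [h1|h1] := ltP (lev a) (lev (hd s)).
    case: low_s h1 => [h|ea] h1; first by move: (lt_le_trans h1 h); rewrite ltxx.
    by rewrite (abscissa_hd _ (ltW h1)) ea addr0 gtrBl.
  have [h2|h2] := ltP (lev (last origin s)) (lev a).
    by rewrite (abscissa_last _ (ltW h2)) addr0 (lt_le_trans ab1).
  rewrite (abscissa_mid _ h1 h2); case/orP: ia => [|/eqP ea]; first exact: ideal_side_vertex.
  by move: h1; rewrite ea /nw_cell lev_west lerBrDr gerDl.
have sx_b : abscissa false s (lev b) <= b.1.
  have [h1|h1] := ltP (lev b) (lev (hd s)).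
    by rewrite (abscissa_hd _ (ltW h1)); move: as1 ab1; clear; lia.
  have [h2|h2] := ltP (lev (last origin s)) (lev b).
    case: high_s h2 => [h|eb] h2; first by move: (lt_le_trans h2 h); rewrite ltxx.
    by rewrite (abscissa_last _ (ltW h2)) eb addr0.
  rewrite (abscissa_mid _ h1 h2); case/orP: fb => [|/eqP eb]; first exact: filter_side_vertex.
  by move: h2; rewrite eb /se_cell /lev /=; clear; lia.
have ka : lev a <= lev (last origin t) by move: bt1 ab1 at2; rewrite /lev; clear; lia.
have kb : lev (hd t) <= lev b by move: at1 ab1 bt2; rewrite /lev; clear; lia.
have lt_ab : lev a < lev b by move: ab1 ab2; rewrite /lev; clear; lia.
have lt_t := lev_hd_last t.
(* If [t] starts well after the level of [a], the comparison moves to the level just before its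
   start; the abscissa of [s] does not decrease on the way. The choice of [q] below is symmetric. *)
have [p [pa pt sp tp pb]] : exists p : int, [/\ lev a <= p, lev (hd t) - 1 <= p,
    abscissa true t p < abscissa false s p, p <= lev (last origin t) & p < lev b].
  have [h|h] := leP (lev (hd t) - 1) (lev a).
    exists (lev a); split=> //; apply: le_lt_trans sx_a.
    have [h1|h1] := ltP (lev a) (lev (hd t)).
      by rewrite (abscissa_hd _ (ltW h1)); move: h1 h at1; clear; lia.
    by rewrite (abscissa_mid _ h1 ka); apply: filter_side_vertex.
  have h1 : lev (hd t) - 1 <= lev (hd t) by rewrite gerBl.
  exists (lev (hd t) - 1); split=> //.
  - exact: ltW.
  - rewrite (abscissa_hd true h1).
    apply: le_lt_trans (lt_le_trans sx_a (abscissa_mono false s (ltW h))).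
    by move: at1; clear; lia.
  - exact: le_trans lt_t.
  - by apply: lt_le_trans kb; rewrite gtrBl.
have [q [qb qt sq pq]] : exists q : int, [/\ q <= lev b, q <= lev (last origin t) + 1,
    abscissa false s q < abscissa true t q & p < q].
  have [h|h] := leP (lev b) (lev (last origin t) + 1).
    exists (lev b); split=> //; apply: le_lt_trans sx_b _.
    have [h1|h1] := ltP (lev (last origin t)) (lev b).
      by rewrite (abscissa_last _ (ltW h1)); move: h1 h bt1; clear; lia.
    by rewrite (abscissa_mid _ kb h1); apply: ideal_side_vertex.
  have h1 : lev (last origin t) <= lev (last origin t) + 1 by rewrite lerDl.
  exists (lev (last origin t) + 1); split=> //.
  - exact: ltW.
  - rewrite (abscissa_last true h1).
    apply: le_lt_trans (le_trans (abscissa_mono false s (ltW h)) sx_b) _.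
    by move: bt1; clear; lia.
  - by rewrite ltzD1.
apply: (clash_of_crossing pq) => //.
  case: low_s => [h|ea]; last by move: pa; rewrite ea /nw_cell lev_west.
  by apply: le_trans pa; apply: le_trans h; rewrite gerBl.
case: high_s => [h|eb].
  by apply: le_trans qb _; apply: le_trans h _; rewrite lerDl.
by move: qb; rewrite eb /se_cell /lev /=; clear; lia.
Qed.

End Crossing.

(** * Linear orders generated by arcs *)

Lemma connect_rev_ind (C : finType) (r : rel C) (z : C) (P : C -> Prop) :
  P z -> (forall x y, r x y -> connect r y z -> P y -> P x) ->
  forall x, connect r x z -> P x.
Proof.
move=> Pz IH x /connectP[p]; elim: p x => [x _ /= <- //|y p IHp x] /= /andP[xy yp] ez.
by apply: IH xy _ _; [apply/connectP; exists p|apply: IHp].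
Qed.

Section JoinOrder.
(** To be read with [lt] the column order, [inc] the strict NW position, and [Bf s], [Af s] the
    ideal and the filter of a segment [s] with end cells [nw s] and [se s]. *)
Variables (C I : finType) (lt inc : rel C) (F : {set I}) (nw se : I -> C) (Bf Af : I -> pred C).
Implicit Types (a b c d e x y z : C) (s t : I).
Let le a b := (a == b) || lt a b.
Hypothesis lt_irr : irreflexive lt.
Hypothesis lt_tr : transitive lt.
Hypothesis lt_total : forall a b, a != b -> lt a b || lt b a.
Hypothesis inc_tr : transitive inc.
Hypothesis inc_lt : forall a b, inc a b -> lt a b.
Hypothesis disj : forall s e, Bf s e -> Af s e -> False.
Hypothesis cover : forall s e, le (nw s) e -> le e (se s) -> Bf s e || Af s e.
Hypothesis Bf_le : forall s e, Bf s e -> le e (se s).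
Hypothesis Af_le : forall s e, Af s e -> le (nw s) e.
Hypothesis Bf_se : forall s, Bf s (se s).
Hypothesis Af_nw : forall s, Af s (nw s).
Hypothesis nw_se : forall s, lt (nw s) (se s).
Hypothesis sides_inc : forall s a b, Bf s b -> Af s a -> lt a b -> inc a b.
Hypothesis Bf_ninc : forall s e, Bf s e -> ~~ inc e (nw s).
Hypothesis Af_ninc : forall s e, Af s e -> ~~ inc (se s) e.
Hypothesis noncrossing : forall s t a b, s \in F -> t \in F -> t != s -> lt a b ->
  le (nw s) a -> le b (se s) -> Af t a -> Bf t b ->
  Bf s a || (a == nw s) -> Af s b || (b == se s) -> False.

Definition arc_step b a : bool := [exists s in F, [&& Bf s b, Af s a & lt a b]].

(* b is placed before the lexicographically smaller a. *)
Notation inverted := (connect arc_step).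

Definition before e f : bool := inverted e f || (lt e f && ~~ inverted f e).

Let le_refl a : le a a. Proof. by rewrite /le eqxx. Qed.
Let ltW a b : lt a b -> le a b. Proof. by rewrite /le => ->; rewrite orbT. Qed.
Let lt_asym a b : lt a b -> lt b a -> False.
Proof. by move=> h1 h2; have := lt_tr h1 h2; rewrite lt_irr. Qed.
Let le_lt_tr a b c : le a b -> lt b c -> lt a c.
Proof. by case/orP=> [/eqP-> //|]; apply: lt_tr. Qed.
Let lt_le_tr a b c : lt a b -> le b c -> lt a c.
Proof. by move=> ab /orP[/eqP<- //|]; apply: lt_tr. Qed.
Let le_tr a b c : le a b -> le b c -> le a c.
Proof. by case/orP=> [/eqP-> //|ab bc]; apply/ltW/(lt_le_tr ab). Qed.
Let le_lt_false a b : le a b -> lt b a -> False.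
Proof. by case/orP=> [/eqP->|h1 h2]; [rewrite lt_irr|apply: lt_asym h1 h2]. Qed.

Let stepP b a : arc_step b a -> exists2 s, s \in F & [/\ Bf s b, Af s a & lt a b].
Proof. by case/exists_inP=> s sF /and3P[h1 h2 h3]; exists s. Qed.

Let step_intro s b a : s \in F -> Bf s b -> Af s a -> lt a b -> arc_step b a.
Proof. by move=> sF h1 h2 h3; apply/exists_inP; exists s; rewrite // h1 h2. Qed.

Lemma arc_step_lt b a : arc_step b a -> lt a b.
Proof. by case/stepP=> s _ []. Qed.

Lemma inverted_le b a : inverted b a -> le a b.
Proof.
move: b; apply: connect_rev_ind => // x y xy _ ya.
by apply/ltW/(le_lt_tr ya)/arc_step_lt.
Qed.

Lemma inverted_inc b a : inverted b a -> (a == b) || inc a b.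
Proof.
move: b; apply: connect_rev_ind => [|x y]; first by rewrite eqxx.
case/stepP=> s _ [h1 h2 h3] _ ih; apply/orP; right; have yx := sides_inc h1 h2 h3.
by case/orP: ih => [/eqP-> //|ay]; apply: inc_tr ay yx.
Qed.

(** Transitivity of the complement: the step of the chain that jumps over [e] belongs to an arc that
    has [e] on one of its sides. *)
Lemma inverted_split b a e : inverted b a -> lt a e -> lt e b -> inverted b e || inverted e a.
Proof.
move=> + ae; move: b; apply: connect_rev_ind => [ea|x y xy ya IH ex].
  by case: (lt_asym ae ea).
have [<-|ey] := eqVneq y e; first by rewrite connect1.
case/orP: (lt_total ey) => h.
  have [s sF [sx sy yx]] := stepP xy.
  have /orP[es|es] : Bf s e || Af s e.
  - apply: cover; first by apply: le_tr (Af_le sy) (ltW h).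
    by apply: le_tr (ltW ex) (Bf_le sx).
  - apply/orP; right; apply: connect_trans ya; apply: connect1; exact: (step_intro sF).
  - apply/orP; left; apply: connect1; exact: (step_intro sF).
case/orP: (IH h) => [ye|->]; rewrite ?orbT //.
by rewrite (connect_trans (connect1 xy)).
Qed.

Lemma before_refl e : before e e.
Proof. by rewrite /before connect0. Qed.

Lemma before_total e f : before e f || before f e.
Proof.
have [->|ef] := eqVneq e f; first by rewrite before_refl.
rewrite /before; case/orP: (lt_total ef) => ->.
  by case: (inverted f e); rewrite ?orbT.
by case: (inverted e f); rewrite ?orbT.
Qed.

Lemma before_inverted e f : before e f -> lt f e -> inverted e f.
Proof. by case/orP=> // /andP[h _] /(lt_asym h). Qed.

Lemma before_ninverted e f : before e f -> lt e f -> ~~ inverted f e.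
Proof. by case/orP=> [/inverted_le h /(le_lt_false h)|/andP[]]. Qed.

Lemma inverted_before e f : inverted e f -> before e f.
Proof. by rewrite /before => ->. Qed.

Lemma before_anti e f : before e f -> before f e -> e = f.
Proof.
move=> ef fe; apply/eqP/negPn/negP => /lt_total/orP[h|h].
  by have := before_inverted fe h; apply/negP/before_ninverted.
by have := before_inverted ef h; apply/negP/before_ninverted.
Qed.

(** The usual criterion for inversion sets of linear orders: the set is transitive by [connect], its
    complement by [inverted_split]. *)
Lemma before_trans : transitive before.
Proof.
move=> f e g ef fg.
have [<-|eg] := eqVneq e g; first exact: before_refl.
have [ef'|nef] := eqVneq e f; first by rewrite ef'.
have [fg'|nfg] := eqVneq f g; first by rewrite -fg'.
case/orP: (lt_total eg) => h.
  rewrite /before h; apply/orP; right; apply/negP => ge.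
  case/orP: (lt_total nef) => h1; case/orP: (lt_total nfg) => h2.
  - case/orP: (inverted_split ge h1 h2); apply/negP; exact: before_ninverted.
  - have := before_ninverted ef h1; rewrite (connect_trans (before_inverted fg h2) ge) //.
  - have := before_ninverted fg h2; rewrite (connect_trans ge (before_inverted ef h1)) //.
  - by case: (lt_asym h (lt_tr h2 h1)).
apply: inverted_before.
case/orP: (lt_total nef) => h1; case/orP: (lt_total nfg) => h2.
- by case: (lt_asym h (lt_tr h1 h2)).
- have := inverted_split (before_inverted fg h2) h h1.
  by rewrite (negPf (before_ninverted ef h1)).
- have := inverted_split (before_inverted ef h1) h2 h.
  by rewrite (negPf (before_ninverted fg h2)) orbF.
- exact: connect_trans (before_inverted ef h1) (before_inverted fg h2).
Qed.

(** Some step of the chain passes from the [Af] side of [s] to the [Bf] side, end cells included.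
    Its arc would cross [s], unless it is [s] and the step leads from [se s] to [nw s]. *)
Lemma no_crossing_chain s a : s \in F -> Bf s a || (a == nw s) -> le (nw s) a ->
  forall b, inverted b a -> Af s b || (b == se s) -> le b (se s) -> b != a ->
  ~~ ((b == se s) && (a == nw s)) -> False.
Proof.
move=> sF Ba na; apply: connect_rev_ind => [|b x bx xa IH Ab bs ba nn]; first by rewrite eqxx.
have [t tF [tb tx xb]] := stepP bx.
have ax : le (nw s) x by apply: le_tr na (inverted_le xa).
have xs : le x (se s) by apply/ltW/(lt_le_tr xb).
have [xe|xn] := boolP (Bf s x || (x == nw s)).
  have [ts|ts] := eqVneq t s; last exact: (noncrossing sF tF ts xb ax bs tx tb xe Ab).
  rewrite ts in tb tx; case/negP: nn; apply/andP; split.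
    by case/orP: Ab => // /(disj tb).
  case/orP: xe => [/disj/(_ tx) //|/eqP ex].
  have := inverted_le xa; rewrite ex => h.
  by case/orP: na => [/eqP->|/(le_lt_false h)].
have xA : Af s x by move: (cover ax xs) xn; case: (Bf s x).
apply: IH => //.
- by rewrite xA.
- by apply: contraNneq xn => ->.
- rewrite negb_and; apply/orP; left; apply/eqP => e.
  by apply: (@disj s (se s)) => //; rewrite -e.
Qed.

Lemma arc_before s : s \in F -> before (se s) (nw s).
Proof. by move=> sF; apply/inverted_before/connect1/(step_intro sF). Qed.

(** An element strictly between gives a chain of inversions that [no_crossing_chain] or
    [noncrossing] forbids. When [e] is outside the [lt]-interval from [nw s] to [se s], the chain is
    cut at the step that jumps over the nearer end. *)
Lemma arc_adjacent s e : s \in F -> before (se s) e -> before e (nw s) ->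
  e = se s \/ e = nw s.
Proof.
move=> sF se_e e_nw.
have [->|es] := eqVneq e (se s); first by left.
have [->|en] := eqVneq e (nw s); first by right.
exfalso; case/orP: (lt_total en) => hn.
  have e_se := lt_tr hn (nw_se s).
  have ne := before_ninverted e_nw hn.
  have : inverted (se s) e := before_inverted se_e e_se.
  suff H b : inverted b e -> inverted (se s) b -> lt (nw s) b -> False by move/H; apply.
  move: b; apply: connect_rev_ind => [_ h|b x bx xe IH sb nb]; first exact: lt_asym hn h.
  have [xn|xn] := eqVneq x (nw s); first by rewrite -xn xe in ne.
  case/orP: (lt_total xn) => hx; last first.
    by apply: IH => //; apply: connect_trans sb (connect1 bx).
  have [t tF [tb tx xb]] := stepP bx.
  have bs : le b (se s) := inverted_le sb.
  (* On the [Bf] side of [t], [nw s] would be inverted with [x], hence with [e], against [ne]. *)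
  have /orP[nt|nt] : Bf t (nw s) || Af t (nw s).
  - apply: cover; first by apply: le_tr (Af_le tx) (ltW hx).
    by apply: le_tr (ltW nb) (Bf_le tb).
  - have h := step_intro tF nt tx hx.
    by rewrite (connect_trans (connect1 h) xe) in ne.
  have ts : t != s by apply/eqP => ts; rewrite ts in tx; exact: (le_lt_false (Af_le tx) hx).
  have [Ab|nAb] := boolP (Af s b || (b == se s)).
    by apply: (noncrossing sF tF ts nb (le_refl _) bs nt tb _ Ab); rewrite eqxx orbT.
  have [nA nse] := norP nAb.
  have Bb : Bf s b by move: (cover (ltW nb) bs); rewrite (negPf nA) orbF.
  apply: (no_crossing_chain sF _ (ltW nb) sb); rewrite ?Bb ?eqxx ?orbT //; first by rewrite eq_sym.
  by apply/eqP => e0; rewrite e0 lt_irr in nb.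
case/orP: (lt_total es) => hs; last first.
  have ne := before_ninverted se_e hs.
  have : inverted e (nw s) := before_inverted e_nw hn.
  suff H b : inverted b (nw s) -> inverted e b -> lt (se s) b -> False by move/H; apply.
  move: b; apply: connect_rev_ind => [_ h|b x bx xn IH eb sb].
    exact: lt_asym (nw_se s) h.
  have [xs|xs] := eqVneq x (se s).
    by rewrite -xs (connect_trans eb (connect1 bx)) in ne.
  case/orP: (lt_total xs) => hx; last first.
    by apply: IH => //; apply: connect_trans eb (connect1 bx).
  have [t tF [tb tx xb]] := stepP bx.
  have nx : le (nw s) x := inverted_le xn.
  have /orP[st|st] : Bf t (se s) || Af t (se s); last 1 first.
  - have h := step_intro tF tb st sb.
    by rewrite (connect_trans eb (connect1 h)) in ne.
  - apply: cover; first by apply: le_tr (Af_le tx) (ltW hx).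
    by apply: le_tr (ltW sb) (Bf_le tb).
  have ts : t != s by apply/eqP => ts; rewrite ts in tb; exact: (le_lt_false (Bf_le tb) sb).
  have [Bx|nBx] := boolP (Bf s x || (x == nw s)).
    by apply: (noncrossing sF tF ts hx nx (le_refl _) tx st Bx); rewrite eqxx orbT.
  have [nB nnw] := norP nBx.
  have Ax : Af s x by move: (cover nx (ltW hx)); rewrite (negPf nB).
  apply: (@no_crossing_chain s (nw s) sF _ (le_refl _) x xn); rewrite ?Ax ?eqxx ?orbT ?andbT //.
  exact: ltW.
case/orP: (cover (ltW hn) (ltW hs)) => h.
  apply: (@no_crossing_chain s e sF _ (ltW hn) (se s) (before_inverted se_e hs));
    by rewrite ?h ?eqxx ?orbT //= eq_sym.
apply: (@no_crossing_chain s (nw s) sF _ (le_refl _) e (before_inverted e_nw hn));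
  by rewrite ?h ?eqxx ?orbT ?andbT //; exact: ltW.
Qed.

(** [e] is before [nw s], and adjacency leaves no place between [se s] and [nw s]. *)
Lemma Bf_before s e : s \in F -> Bf s e -> before e (se s).
Proof.
move=> sF Be; have en : before e (nw s).
  have ne : e != nw s by apply/eqP => ee; apply: (@disj s e) => //; rewrite ee.
  case/orP: (lt_total ne) => h; last first.
    by apply/inverted_before/connect1/(step_intro sF).
  rewrite /before h; apply/orP; right; apply: contraNN (Bf_ninc Be).
  by case/inverted_inc/orP => // /eqP e0; rewrite e0 eqxx in ne.
case/orP: (before_total e (se s)) => // se_e.
have [-> |e0] := arc_adjacent sF se_e en; first exact: before_refl.
by case: (@disj s e) => //; rewrite e0.
Qed.

Lemma Af_before s e : s \in F -> Af s e -> before (nw s) e.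
Proof.
move=> sF Ae; have en : before (se s) e.
  have ne : se s != e by apply/eqP => ee; apply: (@disj s e) => //; rewrite -ee.
  case/orP: (lt_total ne) => h; last first.
    by apply/inverted_before/connect1/(step_intro sF).
  rewrite /before h; apply/orP; right; apply: contraNN (Af_ninc Ae).
  by case/inverted_inc/orP => // /eqP e0; rewrite e0 eqxx in ne.
case/orP: (before_total (nw s) e) => // e_nw.
have [e0|->] := arc_adjacent sF en e_nw; last exact: before_refl.
by case: (@disj s e) => //; rewrite e0.
Qed.

(** A chain of inversions has no intermediate element here, so one arc [s] inverts the pair. Both
    [se s] and [nw s] then lie between [d] and [c]. *)
Lemma adjacent_arc c d : before d c -> lt c d ->
  (forall e, before d e -> before e c -> e = d \/ e = c) ->
  exists2 s, s \in F & d = se s /\ c = nw s.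
Proof.
move=> dc cd adj; have := before_inverted dc cd.
case/connectP=> -[|x p] /= => [_ e|/andP[dx xp] e]; first by rewrite e lt_irr in cd.
have xc : inverted x c by apply/connectP; exists p.
have xd : lt x d := arc_step_lt dx.
have [x0|x0] := adj x (inverted_before (connect1 dx)) (inverted_before xc).
  by rewrite x0 lt_irr in xd.
rewrite x0 in dx; have [s sF [sd sc _]] := stepP dx; exists s => //.
have h1 := Bf_before sF sd; have h2 := Af_before sF sc; have h3 := arc_before sF.
have [<-|se_c] := adj (se s) h1 (before_trans h3 h2); last first.
  by case: (@disj s (se s)) => //; rewrite se_c.
have [nd|<-//] := adj (nw s) (before_trans h1 h3) h2.
by case: (@disj s (nw s)) => //; rewrite nd.
Qed.

Lemma ninc_before e f : lt e f -> ~~ inc e f -> before e f.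
Proof.
move=> ef ninc; rewrite /before ef; apply/orP; right; apply: contraNN ninc.
by case/inverted_inc/orP => // /eqP e0; rewrite e0 lt_irr in ef.
Qed.

Lemma join_order : exists bef : rel C,
  [/\ [/\ forall e f, bef e f || bef f e, forall e f, bef e f -> bef f e -> e = f,
          transitive bef & forall e f, lt e f -> ~~ inc e f -> bef e f],
      forall s, s \in F -> [/\ bef (se s) (nw s),
        forall e, bef (se s) e -> bef e (nw s) -> e = se s \/ e = nw s,
        forall e, Bf s e -> bef e (se s) & forall e, Af s e -> bef (nw s) e] &
      forall c d, bef d c -> lt c d ->
        (forall e, bef d e -> bef e c -> e = d \/ e = c) ->
        exists2 s, s \in F & d = se s /\ c = nw s].
Proof.
exists before; split.
- split; [exact: before_total|exact: before_anti|exact: before_trans|exact: ninc_before].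
- move=> s sF; split; first exact: arc_before.
  + by move=> e; apply: arc_adjacent.
  + by move=> e; apply: Bf_before.
  + by move=> e; apply: Af_before.
- exact: adjacent_arc.
Qed.

End JoinOrder.

(** * Tableaux *)

Section Tableaux.
Variable lam : grid_shape.
Notation seg := (segment lam).
Notation cell := (cells lam).
Notation tableau := {ffun cells lam -> 'I_#|` cells lam|}.
Implicit Types (s t p : seg) (v w : point) (a b c d e : cells lam) (T : tableau).

Lemma mem_cells v : (v \in cells lam) = has_cell lam v.
Proof. by rewrite !inE /=; apply: andb_idl => /and4P[]. Qed.

Lemma has_cell_cell v : has_cell lam v -> exists e : cell, val e = v.
Proof. by rewrite -mem_cells => h; exists [` h]%fset. Qed.

Lemma cell_has_cell e : has_cell lam (val e).
Proof. by rewrite -mem_cells; apply: valP. Qed.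

Lemma interior_cells v : interior lam v ->
  [/\ has_cell lam v, has_cell lam (west v), has_cell lam (south v) & has_cell lam (west (south v))].
Proof. by rewrite /interior /= => /and5P[]. Qed.

Fact nw_cell_subproof s : nw_cell s \in cells lam.
Proof. by rewrite mem_cells; have [] := interior_cells (hd_interior s). Qed.
Fact se_cell_subproof s : se_cell s \in cells lam.
Proof. by rewrite mem_cells; have [] := interior_cells (last_interior s). Qed.

Definition first_cell s : cell := [` nw_cell_subproof s]%fset.
Definition last_cell s : cell := [` se_cell_subproof s]%fset.

Lemma SYT_inj T : T \in SYT lam -> injective T.
Proof. by rewrite inE => /andP[/injectiveP]. Qed.

Lemma SYT_le T c d : T \in SYT lam -> cell_le (val c) (val d) -> (T c <= T d)%N.
Proof. by rewrite inE => /andP[_ /'forall_forallP h] /(implyP (h c d)). Qed.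

Lemma card_cells : #|{: cell}| = #|` cells lam|.
Proof. by rewrite cardfE. Qed.

Lemma SYT_label T (k : nat) : T \in SYT lam -> (k < #|` cells lam|)%N -> exists c, T c = k :> nat.
Proof.
move=> TS kN; have bT : bijective T.
  by apply: inj_card_bij; [exact: SYT_inj|rewrite card_ord card_cells].
by case: bT => g _ gK; exists (g (Ordinal kN)); rewrite gK.
Qed.

(* For a standard tableau T this amounts to s \in Des T. *)
Definition fits T s : Prop :=
  [/\ T (first_cell s) = (T (last_cell s)).+1 :> nat,
      forall e, ideal_side s (val e) -> (T e <= T (last_cell s))%N &
      forall e, filter_side s (val e) -> (T (first_cell s) <= T e)%N].

Lemma filled_uptoE T d e : filled_upto T d (val e) = (T e <= T d)%N.
Proof.
apply/existsP/idP => [[e' /andP[/eqP/val_inj-> //]]|h].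
by exists e; rewrite eqxx.
Qed.

Lemma first_cell_neq s e : val e \in vertices s -> e != first_cell s.
Proof.
move=> es; apply/eqP => e0; have [h _ _ _] := hd_last_extreme es.
by move: h; rewrite e0 /= leNgt gtrBl.
Qed.

Lemma fits_Des T s : T \in SYT lam -> fits T s -> s \in Des T.
Proof.
move=> TS [adj low high]; rewrite inE; apply/existsP; exists (last_cell s).
apply/existsP; exists (first_cell s); rewrite /descent /descent_segment adj eqxx /=.
have ext := hd_last_extreme (last_mem s).
have inU v : v \in vertices s -> filled_upto T (first_cell s) (west (south v)).
  move=> vs; have [_ _ _] := interior_cells (seg_interior vs) => /has_cell_cell[e ee].
  rewrite -ee filled_uptoE adj; apply: leqW; apply: low; rewrite ee; exact: sw_ideal.
have outU v : v \in vertices s -> ~~ filled_upto T (first_cell s) v.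
  move=> vs; have [/has_cell_cell[e ee] _ _ _] := interior_cells (seg_interior vs).
  rewrite -ee filled_uptoE -ltnNge ltn_neqAle high ?ee ?ne_filter // andbT.
  apply: contraNneq (@first_cell_neq s e _) => [/esym/ord_inj/(SYT_inj TS) -> //|].
  by rewrite ee.
apply/and4P; split.
- rewrite /strictly_NW /nw_cell /se_cell /=; case: ext.
  by move: (hd s) (last origin s) => h l /=; clear; lia.
- by rewrite /SE_corner /nw_cell -[X in _ == X]/(east (west (hd s))) point_eqE /= subrK !eqxx.
- by rewrite /NW_corner /se_cell point_eqE /= subrK !eqxx.
apply/andP; split.
  apply/allP => v vs; rewrite /boundary_vertex; apply/andP; split.
    by apply/hasP; exists (west (south v)); rewrite ?inU // !inE eqxx !orbT.
  by apply/allPn; exists v; rewrite ?outU // mem_head.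
have /and3P[_ _ ss] := segmentP s.
apply: (@sub_in_sorted _ (mem (vertices s)) seg_step) ss; last exact/allP.
move=> v w vs ws; rewrite /boundary_edge => vw.
have nv := outU v vs; have nw := outU w ws; have iv := inU v vs; have iw := inU w ws.
case: eqP => [we|nwe].
  have -> : south v = west (south w) by rewrite we; apply/eqP; rewrite point_eqE /= addrK !eqxx.
  by rewrite iw (negPf nv).
have ws' : w = south v by case/orP: vw => /eqP.
by rewrite (negPf nw) ws' iv.
Qed.

(** Among the four cells at a boundary vertex the SW one is least and the NE one greatest, so the
    former is filled and the latter is not. *)
Lemma Des_fits T s : T \in SYT lam -> s \in Des T -> fits T s.
Proof.
move=> TS; rewrite inE => /existsP[c /existsP[d /andP[/andP[/eqP Tdc _]]]].
case/and3P=> /eqP hs /eqP ls /andP[/allP bs _].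
have ed : d = first_cell s.
  apply: val_inj; rewrite /= /nw_cell hs; apply/eqP.
  by rewrite point_eqE /= addrK !eqxx.
have ec : c = last_cell s.
  apply: val_inj; rewrite /= /se_cell ls; apply/eqP.
  by rewrite point_eqE /= addrK !eqxx.
rewrite ed ec in Tdc bs.
have lowU v : v \in vertices s -> filled_upto T (first_cell s) (west (south v)).
  move=> vs; have [h1 h2 h3 /has_cell_cell[e ee]] := interior_cells (seg_interior vs).
  have /andP[/hasP[g gv gU] _] := bs v vs.
  rewrite -ee filled_uptoE; have [f /andP[/eqP ef fU]] := existsP gU.
  apply: leq_trans fU; apply: SYT_le => //; rewrite ee ef /cell_le.
  by move: gv; rewrite !inE => /or4P[] /eqP-> /=; clear; lia.
have highU v : v \in vertices s -> ~~ filled_upto T (first_cell s) v.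
  move=> vs; have [/has_cell_cell[e ee] h2 h3 h4] := interior_cells (seg_interior vs).
  have /andP[_ /allPn[g gv gU]] := bs v vs.
  have [f ef] : exists f : cell, val f = g.
    by apply: has_cell_cell; move: gv; rewrite !inE => /or4P[] /eqP-> //; rewrite -ee cell_has_cell.
  apply: contraNN gU; rewrite -ee -ef !filled_uptoE; apply: leq_trans.
  apply: SYT_le => //; rewrite ee ef /cell_le.
  by move: gv; rewrite !inE => /or4P[] /eqP-> /=; clear; lia.
split=> // e.
  case/hasP=> g; rewrite in_cons => /orP[/eqP->|/mapP[v vs ->]] eg.
    by apply: SYT_le.
  have [_ _ _ /has_cell_cell[f ef]] := interior_cells (seg_interior vs).
  have := lowU v vs; rewrite -ef filled_uptoE Tdc => fU.
  rewrite -ef in eg; have ef' := SYT_le TS eg.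
  (* The filled cells include [first_cell s], so to lower the bound by one [f] must differ from it;
     the two lie on different sides. *)
  rewrite -ltnS; apply: leq_ltn_trans ef' _; rewrite ltn_neqAle fU andbT -Tdc.
  apply/eqP => /ord_inj/(SYT_inj TS) f0; apply: (@sides_disjoint lam s (val f)).
    by rewrite ef sw_ideal.
  by rewrite f0; apply: nw_cell_filter.
case/hasP=> g; rewrite in_cons => /orP[/eqP->|vs] ge; first exact: SYT_le.
have [/has_cell_cell[f ef] _ _ _] := interior_cells (seg_interior vs).
have := highU g vs; rewrite -ef filled_uptoE -ltnNge => fU.
by rewrite -ef in ge; apply: leq_trans (ltnW fU) (SYT_le TS ge).
Qed.

End Tableaux.

(** * Uniqueness, compatibility and existence of descent segments *)

Section DescentSets.
Variable lam : grid_shape.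
Notation seg := (segment lam).
Notation cell := (cells lam).
Notation tableau := {ffun cells lam -> 'I_#|` cells lam|}.
Implicit Types (s t p : seg) (v w : point) (a b c d e : cells lam) (T : tableau).

(** Where two such segments diverge, one cell is NE of a vertex of the first and SW of a vertex of
    the second, and its label contradicts one of the two bounds. *)
Lemma fits_uniq T s t : fits T s -> fits T t ->
  first_cell s = first_cell t -> last_cell s = last_cell t -> s = t.
Proof.
move=> fs ft hst lst.
have hh : hd s = hd t.
  have := congr1 val hst; rewrite /= /nw_cell => -[h1 h2].
  by apply/eqP; rewrite point_eqE h2 (addIr _ h1) !eqxx.
have ll : last origin s = last origin t.
  have := congr1 val lst; rewrite /= /se_cell => -[h1 h2].
  by apply/eqP; rewrite point_eqE h1 (addIr _ h2) !eqxx.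
have H (x y : seg) : fits T x -> fits T y -> first_cell x = first_cell y ->
    last_cell x = last_cell y -> hd x = hd y ->
    last origin x = last origin y -> below true (hd x) (behead x) (behead y) -> False.
  move=> [adj lowx highx] [_ lowy highy] fxy lxy hxy lastxy xy.
  have yp := seg_path y; rewrite -hxy in yp.
  have [u [p2 [q2 [ex ey l1 l2]]]] := below_split (seg_path x) yp xy.
  rewrite -seg_cons in ex; rewrite hxy -seg_cons -hxy in ey.
  have sz : size (vertices x) = size (vertices y).
    have := lev_last x; rewrite lastxy lev_last hxy => /addrI [].
    by rewrite [in size x]seg_cons [in size y]seg_cons /= => ->.
  case: p2 q2 l1 l2 ex ey => [|w p2] [|z q2] //.
  - by move=> _ _ ex ey; move: xy; rewrite [in behead x]ex [in behead y]ey below_irr.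
  - by move=> _ _ ex ey; move: sz; rewrite ex ey !size_cat /= addn0 addnS => /eqP; rewrite -[X in X == _]addn0 -addnS eqn_add2l.
  - by move=> _ _ ex ey; move: sz; rewrite ex ey !size_cat /= addn0 addnS => /eqP; rewrite -[X in _ == X]addn0 -addnS eqn_add2l.
  rewrite /leaves /= => /eqP ew /eqP ez ex ey.
  have wx : w \in vertices x by rewrite ex in_cons mem_cat mem_head !orbT.
  have zy : z \in vertices y by rewrite ey in_cons mem_cat mem_head !orbT.
  have zw : west (south z) = w.
    by rewrite ew ez; apply/eqP; rewrite point_eqE /= addrK !eqxx.
  have [/has_cell_cell[e ee] _ _ _] := interior_cells (seg_interior wx).
  have h1 := highx e; have h2 := lowy e.
  rewrite ee in h1 h2; have := leq_trans (h1 (ne_filter wx)) (h2 _).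
  by rewrite -zw sw_ideal // adj lxy ltnn => /(_ isT).
apply/eqP/negPn/negP => st.
have nb : behead s != behead t.
  by apply: contraNneq st => e; rewrite -val_eqE /= (seg_cons s) (seg_cons t) hh e.
have tp := seg_path t; rewrite -hh in tp.
case/orP: (below_total true (seg_path s) tp nb); first exact: H.
by rewrite hh; apply: H.
Qed.

(** In a crossing, the cell west of the head of [u] and the cell south of its last vertex squeeze
    the labels of the end cells, so both segments have the same end cells. *)
Lemma Des_compatible T : T \in SYT lam -> Des T \in compatible_family lam true.
Proof.
move=> TS; apply/compatible_familyP => s t sD tD st; apply/negP => /clashP.
move=> [s1 [s2 [t1 [t2 [u [es et u0 /andP[ws ls] /andP[nt lt]]]]]]].
have fs := Des_fits TS sD; have ft := Des_fits TS tD.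
have [adjs lows highs] := fs; have [adjt lowt hight] := ft.
have memu v : v \in u -> v \in vertices s by rewrite es !mem_cat => ->; rewrite orbT.
have hu : hd u \in u by case: (u) u0 => //= x y _; apply: mem_head.
have lu : last origin u \in u by case: (u) u0 => //= x y _; apply: mem_last.
have [_ /has_cell_cell[a ea] _ _] := interior_cells (seg_interior (memu _ hu)).
have [_ _ /has_cell_cell[b eb] _] := interior_cells (seg_interior (memu _ lu)).
have mem_before (r : seg) (r1 r2 : seq point) : vertices r = r1 ++ u ++ r2 -> r1 != [::] -> last origin r1 \in vertices r.
  by case: r1 => // x r1 -> _; rewrite mem_cat [last _ _]/= mem_last.
have mem_after (r : seg) (r1 r2 : seq point) : vertices r = r1 ++ u ++ r2 -> r2 != [::] -> hd r2 \in vertices r.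
  by case: r2 => // x r2 -> _; rewrite !mem_cat [hd _]/= mem_head !orbT.
have as_ : (T (first_cell s) <= T a)%N.
  apply: highs; rewrite ea; case/orP: ws => [/eqP s0|/eqP s0].
    have -> : hd u = hd s by rewrite es s0; case: (u) u0.
    exact: nw_cell_filter.
  case: (eqVneq s1 [::]) => [s0'|n1].
    have -> : hd u = hd s by rewrite es s0'; case: (u) u0.
    exact: nw_cell_filter.
  by rewrite -s0; apply/ne_filter/(mem_before _ _ _ es).
have at_ : (T a <= T (first_cell t))%N.
  case: (eqVneq t1 [::]) => [t0|n1].
    have -> : a = first_cell t; last by [].
    by apply: val_inj; rewrite ea /= /nw_cell et t0; case: (u) u0.
  have t0 : last origin t1 = north (hd u) by move: nt; rewrite /enters (negPf n1) => /eqP.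
  rewrite adjt; apply: leqW; apply: lowt; rewrite ea.
  have -> : west (hd u) = west (south (last origin t1)).
    by rewrite t0; apply/eqP; rewrite point_eqE /= addrK !eqxx.
  exact/sw_ideal/(mem_before _ _ _ et).
have bs_ : (T b <= T (last_cell s))%N.
  apply: lows; rewrite eb; case: (eqVneq s2 [::]) => [s0|n1].
    have -> : last origin u = last origin s.
      by rewrite es s0 cats0 last_cat; case: (u) u0.
    exact: se_cell_ideal.
  have s0 : hd s2 = east (last origin u) by move: ls; rewrite /leaves (negPf n1) => /eqP.
  have -> : south (last origin u) = west (south (hd s2)).
    by rewrite s0; apply/eqP; rewrite point_eqE /= addrK !eqxx.
  exact/sw_ideal/(mem_after _ _ _ es).
have bt_ : (T (last_cell t) <= T b)%N.
  case: (eqVneq t2 [::]) => [t0|n1].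
    have -> : b = last_cell t; last by [].
    by apply: val_inj; rewrite eb /= /se_cell et t0 cats0 last_cat; case: (u) u0.
  have t0 : hd t2 = south (last origin u) by move: lt; rewrite /leaves (negPf n1) => /eqP.
  apply: ltnW; rewrite -adjt; apply: hight; rewrite eb -t0.
  exact/ne_filter/(mem_after _ _ _ et).
have e1 : T (last_cell s) = T (last_cell t).
  apply/val_inj/eqP; rewrite /= eqn_leq; apply/andP; split.
    by rewrite -ltnS -adjs -adjt; apply: leq_trans at_.
  exact: leq_trans bs_.
have e2 : T (first_cell s) = T (first_cell t).
  by apply/val_inj; rewrite /= adjs adjt e1.
case/eqP: st; apply: (fits_uniq fs ft); exact: (SYT_inj TS).
Qed.

Hypothesis rectangle : forall u v w : point, has_cell lam u -> has_cell lam v ->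
  u.1 <= w.1 -> w.1 <= v.1 -> v.2 <= w.2 -> w.2 <= u.2 -> has_cell lam w.

(** Traces the boundary of the cells labelled at most [T c]: east if the cell SE of [v] is among
    them, south otherwise. The two label conditions are the invariant, and the distance to the
    NW-corner of [c] decreases. *)
Lemma boundary_path T c d (pc pd : point) : T \in SYT lam -> T d = (T c).+1 :> nat ->
  val c = pc -> val d = pd -> forall (n : nat) v, `|(pc.1 - v.1)%R| + `|(v.2 - pc.2)%R| = n ->
  pd.1 < v.1 -> v.1 <= pc.1 -> pc.2 < v.2 -> v.2 <= pd.2 ->
  (forall e, val e = west (south v) -> (T e <= T c)%N) ->
  (forall e, val e = v -> (T d <= T e)%N) ->
  exists q : seq point, [/\ is_segment lam (v :: q), last v q = north pc,
    forall e x, x \in v :: q -> val e = west (south x) -> (T e <= T c)%N &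
    forall e x, x \in v :: q -> val e = x -> (T d <= T e)%N].
Proof.
move=> TS adj ec ed; elim/ltn_ind=> n IHn v en dv vc cv vd low high.
have rect w : pd.1 <= w.1 -> w.1 <= pc.1 -> pc.2 <= w.2 -> w.2 <= pd.2 -> has_cell lam w.
  by rewrite -ec -ed; apply: rectangle (cell_has_cell d) (cell_has_cell c).
have vint : interior lam v.
  apply/and5P; split=> //; apply: rect => /=; move: dv vc cv vd; clear; lia.
have [b eb] : exists b : cell, val b = south v.
  by apply: has_cell_cell; have [] := interior_cells vint.
have [ve|vne] := eqVneq v (north pc).
  exists [::]; split=> //; first by rewrite is_segment_cons vint.
    by move=> e x; rewrite inE => /eqP-> /low.
  by move=> e x; rewrite inE => /eqP-> /high.
have next w : seg_step v w -> (`|(pc.1 - w.1)%R| + `|(w.2 - pc.2)%R| < n)%N ->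
    pd.1 < w.1 -> w.1 <= pc.1 -> pc.2 < w.2 -> w.2 <= pd.2 ->
    (forall e, val e = west (south w) -> (T e <= T c)%N) ->
    (forall e, val e = w -> (T d <= T e)%N) ->
    exists q : seq point, [/\ is_segment lam (v :: q), last v q = north pc,
      forall e x, x \in v :: q -> val e = west (south x) -> (T e <= T c)%N &
      forall e x, x \in v :: q -> val e = x -> (T d <= T e)%N].
  move=> vw wn dw wc cw wd loww highw.
  have [q [q1 q2 q3 q4]] := IHn _ wn w erefl dw wc cw wd loww highw.
  exists (w :: q); split=> //; first by rewrite is_segment_cons vint /= vw q1.
    by move=> e x; rewrite inE => /orP[/eqP-> /low //|]; apply: q3.
  by move=> e x; rewrite inE => /orP[/eqP-> /high //|]; apply: q4.
have [bc|cb] := leqP (T b) (T c).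
  have vlt : v.1 < pc.1.
    rewrite lt_neqAle vc andbT; apply/eqP => v1; case/negP: vne.
    have : T c = T b.
      apply/val_inj/eqP; rewrite /= eqn_leq bc andbT; apply: SYT_le => //.
      by rewrite eb ec /cell_le /=; move: v1 cv; clear; lia.
    by move/(SYT_inj TS) => cb; rewrite -ec cb eb point_eqE /= subrK !eqxx.
  apply: (next (east v)) => //=.
  - by rewrite /seg_step eqxx orbT.
  - by move: en vlt cv; clear; lia.
  - by move: dv; clear; lia.
  - by move: vlt; clear; lia.
  - move=> e ee; suff -> : e = b by [].
    by apply: val_inj; rewrite /= ee eb; apply/eqP; rewrite point_eqE /= addrK !eqxx.
  - move=> e ee; have [f ef] : exists f : cell, val f = v.
      by apply: has_cell_cell; have [] := interior_cells vint.
    apply: leq_trans (high f ef) _; apply: SYT_le => //.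
    by move: ef ee; rewrite /= => -> ->; rewrite /cell_le /= lexx andbT lerDl.
have vlt : pc.2 + 1 < v.2.
  rewrite ltNge; apply/negP => h; move: cb; rewrite ltnNge => /negP; apply.
  by apply: SYT_le => //; rewrite eb ec /cell_le /=; move: h vc; clear; lia.
apply: (next (south v)) => //=.
- by rewrite /seg_step eqxx.
- by move: en vlt vc; clear; lia.
- by move: vlt; clear; lia.
- by move: vd; clear; lia.
- move=> e ee; have [f ef] : exists f : cell, val f = west (south v).
    by apply: has_cell_cell; have [] := interior_cells vint.
  apply: leq_trans (low f ef); apply: SYT_le => //.
  by move: ef ee; rewrite /= => -> ->; rewrite /cell_le /= lexx /=; clear; lia.
- by move=> e ee; have -> : e = b by [apply: val_inj; rewrite /= ee eb]; rewrite adj.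
Qed.

Lemma descent_Des T c d : T \in SYT lam -> descent T c d ->
  exists s, [/\ s \in Des T, first_cell s = d & last_cell s = c].
Proof.
move=> TS /andP[/eqP adj].
have [pc ec] : exists pc : point, val c = pc by exists (val c).
have [pd ed] : exists pd : point, val d = pd by exists (val d).
rewrite ec ed => /andP[dc1 cd2].
have [||||e ee|e ee|q [qs ql low high]] :=
   boundary_path TS adj ec ed (v := east pd) erefl.
- by rewrite /= ltrDl.
- by rewrite /= lezD1.
- exact: cd2.
- exact: lexx.
- have : (T e <= T d)%N.
    by apply: SYT_le => //; rewrite ee ed /cell_le /=; clear; lia.
  rewrite leq_eqVlt adj ltnS -adj => /orP[/eqP Ted|//].
  have e_d : e = d by apply/(SYT_inj TS)/ord_inj; rewrite Ted adj.
  by move: ee; rewrite e_d ed => /(congr1 snd) /=; clear; lia.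
- by apply: SYT_le => //; rewrite ee ed /cell_le /= lexx andbT lerDl.
pose s := Segment qs.
have fd : first_cell s = d.
  by apply: val_inj; rewrite /= /nw_cell /= ed; apply/eqP; rewrite point_eqE /= addrK !eqxx.
have lc : last_cell s = c.
  by apply: val_inj; rewrite /= /se_cell /= ql ec; apply/eqP; rewrite point_eqE /= addrK !eqxx.
exists s; split=> //; apply: fits_Des => //; split; rewrite ?fd ?lc //.
- move=> e /hasP[g]; rewrite in_cons => /orP[/eqP->|/mapP[v vs ->]] eg.
    by apply: SYT_le; rewrite // -lc.
  have [_ _ _ /has_cell_cell[f ef]] := interior_cells (seg_interior (p := s) vs).
  by apply: leq_trans (low f v vs ef); apply: SYT_le; rewrite // ef.
- move=> e /hasP[g]; rewrite in_cons => /orP[/eqP->|vs] ge.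
    by apply: SYT_le; rewrite // -fd.
  have [/has_cell_cell[f ef] _ _ _] := interior_cells (seg_interior (p := s) vs).
  by apply: leq_trans (high f g vs ef) _; apply: SYT_le; rewrite // ef.
Qed.

End DescentSets.

(** * The descent set as a bijection onto the noncrossing families *)

Section Bijection.
Variable lam : grid_shape.
Notation seg := (segment lam).
Notation cell := (cells lam).
Notation tableau := {ffun cells lam -> 'I_#|` cells lam|}.
Implicit Types (F : {set seg}) (s t p : seg) (v w : point) (a b c d e : cells lam) (T : tableau).
Hypothesis rectangle : forall u v w : point, has_cell lam u -> has_cell lam v ->
  u.1 <= w.1 -> w.1 <= v.1 -> v.2 <= w.2 -> w.2 <= u.2 -> has_cell lam w.

Definition cell_lt c d : bool := lex_lt (val c) (val d).

Lemma lex_lt_irr : irreflexive lex_lt. Proof. by move=> v; rewrite /lex_lt; lia. Qed.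
Lemma lex_lt_trans : transitive lex_lt.
Proof. by move=> v u w; rewrite /lex_lt; lia. Qed.
Lemma lex_lt_total v w : v != w -> lex_lt v w || lex_lt w v.
Proof. by rewrite point_eqE /lex_lt; lia. Qed.
Lemma cell_le_lex v w : cell_le v w -> ~~ lex_lt w v.
Proof. by rewrite /cell_le /lex_lt; lia. Qed.

Lemma cell_lt_total c d : c != d -> cell_lt c d || cell_lt d c.
Proof. by move=> cd; apply: lex_lt_total; rewrite (inj_eq val_inj). Qed.

Lemma cell_leE c d : (c == d) || cell_lt c d = lex_le (val c) (val d).
Proof. by rewrite /lex_le (inj_eq val_inj). Qed.

(** An inversion either splits into two with smaller label differences or is caused by one descent
    segment, whose sides do not depend on the tableau. *)
Lemma Des_eq_inversion T T' : T \in SYT lam -> T' \in SYT lam -> Des T = Des T' ->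
  forall a b, cell_lt a b -> (T b < T a)%N -> (T' b < T' a)%N.
Proof.
move=> TS TS' eD; suff H n : forall a b, (T a - T b <= n)%N -> cell_lt a b ->
    (T b < T a)%N -> (T' b < T' a)%N by move=> a b; apply: (H _ a b (leqnn _)).
elim: n => [|n IHn] a b; first by rewrite leqn0 subn_eq0 leqNgt => /negP h _ /h.
move=> nab ab Tba.
(* [e] gets the least label above that of [b] among the cells not after [a]; the cell [f] labelled
   just before it then comes after [a]. *)
have exk : exists k : nat, [exists e, [&& T e == k :> nat, (T b < T e)%N & lex_le (val e) (val a)]].
  by exists (T a); apply/existsP; exists a; rewrite eqxx Tba /lex_le eqxx.
have [k /existsP[e /and3P[/eqP Te be ea]] kmin] := ex_minnP exk.
have ka : (k <= T a)%N.
  by apply: kmin; apply/existsP; exists a; rewrite eqxx Tba /lex_le eqxx.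
have bk : (T b <= k.-1)%N by move: be; rewrite Te; case: (k).
have k0 : (0 < k)%N by rewrite -Te (leq_ltn_trans _ be).
have kN : (k.-1 < #|` cells lam|)%N by apply: leq_ltn_trans (leq_pred _) _; rewrite -Te.
have [f Tf] := SYT_label TS kN.
have fa : cell_lt a f.
  have [fe|fe] := eqVneq f b; first by rewrite fe.
  have Tbf : (T b < T f)%N.
    rewrite ltn_neqAle Tf bk andbT -Tf; apply: contraNneq fe => /esym/ord_inj.
    by move/(SYT_inj TS)->.
  have [//|nfa] := boolP (cell_lt a f).
  have : (k <= k.-1)%N; last by rewrite leqNgt prednK ?leqnn.
  apply: kmin; apply/existsP; exists f; rewrite Tf eqxx -Tf Tbf /=.
  rewrite -cell_leE; have [//|/cell_lt_total] := eqVneq f a.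
  by rewrite (negPf nfa) orbF => ->.
have ef : lex_lt (val e) (val f).
  by case/orP: ea => [/eqP->//|/lex_lt_trans]; apply.
have adj : T e = (T f).+1 :> nat by rewrite Tf prednK // Te.
(* If [f] precedes [b], the inversion splits at [f]. Otherwise [a] and [b] are in the column-order
   interval of the descent from [f] to [e], and its segment separates them. *)
have [fb|bf] := boolP (cell_lt f b).
  have Tbf : (T b < T f)%N.
    rewrite ltn_neqAle Tf bk andbT -Tf; apply: contraTneq fb => /ord_inj.
    by move/(SYT_inj TS) ->; rewrite /cell_lt lex_lt_irr.
  have Tfa : (T f < T a)%N by rewrite Tf (leq_trans _ ka) ?prednK.
  apply: (@ltn_trans (T' f)); apply: IHn => //; move: nab Tbf Tfa; clear; lia.
have {}bf : lex_le (val b) (val f).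
  by rewrite -cell_leE; have [//|/cell_lt_total] := eqVneq b f; rewrite (negPf bf) orbF => ->.
have Dfe : descent T f e.
  rewrite /descent adj eqxx /=; apply: lex_strictly_NW => //; apply/negP.
  by rewrite -[cell_le _ _]/(cell_le (val e) (val f)) => /(SYT_le TS); rewrite adj ltnn.
have [s [sD se sf]] := descent_Des rectangle TS Dfe.
have [_ low high] := Des_fits TS sD; rewrite eD in sD.
have [adj' low' high'] := Des_fits TS' sD.
rewrite se sf in low high adj' low' high'.
have cov (x : cell) : lex_le (val e) (val x) -> lex_le (val x) (val f) ->
    ideal_side s (val x) || filter_side s (val x).
  move=> h1 h2; apply: sides_cover; first by rewrite -[nw_cell s]/(val (first_cell s)) se.
  by rewrite -[se_cell s]/(val (last_cell s)) sf.
have eb : lex_le (val e) (val b).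
  by apply/orP; right; case/orP: ea => [/eqP->//|/lex_lt_trans]; apply.
have af : lex_le (val a) (val f) by apply/orP; right.
have bs : ideal_side s (val b).
  by case/orP: (cov b eb bf) => // /high; rewrite leqNgt be.
have as_ : filter_side s (val a).
  by case/orP: (cov a ea af) => // /low; rewrite Tf leqNgt prednK // ka.
by apply: leq_ltn_trans (low' b bs) _; rewrite -adj'; apply: high'.
Qed.

Lemma SYT_eq T T' : T \in SYT lam -> T' \in SYT lam ->
  (forall c d, (T c < T d)%N = (T' c < T' d)%N) -> T = T'.
Proof.
have H (U V : tableau) : U \in SYT lam -> (forall c d, (U c < U d)%N -> (V c < V d)%N) ->
    forall n c, U c = n :> nat -> (n <= V c)%N.
  move=> US UV; elim=> // n IHn c Uc.
  have [d Ud] : exists d, U d = n :> nat.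
    by apply: SYT_label => //; apply: ltn_trans (ltn_ord (U c)); rewrite Uc.
  by apply: leq_ltn_trans (IHn d Ud) _; apply: UV; rewrite Uc Ud.
move=> TS TS' TT; apply/ffunP=> c; apply/val_inj/eqP; rewrite /= eqn_leq.
by rewrite (H T T' TS _ (T c) c) ?(H T' T TS' _ (T' c) c) // => a b; rewrite TT.
Qed.

Lemma Des_inj : {in SYT lam &, injective (@Des lam)}.
Proof.
move=> T T' TS TS' eD.
have D := Des_eq_inversion TS TS' eD; have D' := Des_eq_inversion TS' TS (esym eD).
apply: SYT_eq => // c d; have [->|cd] := eqVneq c d; first by rewrite !ltnn.
case/orP: (cell_lt_total cd) => h; last by apply/idP/idP; [apply: D|apply: D'].
have flip (U : tableau) : U \in SYT lam -> (U c < U d)%N = ~~ (U d < U c)%N.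
  move=> US; rewrite -leqNgt [RHS]leq_eqVlt; case: eqP => [/ord_inj/(SYT_inj US) e|//].
  by rewrite e eqxx in cd.
by rewrite !flip //; congr negb; apply/idP/idP; [apply: D|apply: D'].
Qed.

(** The labels are the ranks in the order generated by [F]. Conversely a descent is an adjacent
    inverted pair, hence the pair of end cells of a member, and [fits_uniq] identifies the
    segments. *)
Lemma Des_surj F : F \in compatible_family lam true -> exists2 T, T \in SYT lam & Des T = F.
Proof.
move=> Fc.
pose Bf s : pred cell := fun e => ideal_side s (val e).
pose Af s : pred cell := fun e => filter_side s (val e).
pose inc : rel cell := fun a b => strictly_NW (val a) (val b).
have inc_tr : transitive inc.
  by move=> c d e; rewrite /inc /strictly_NW => /andP[h1 h2] /andP[h3 h4]; rewrite (lt_trans h1) // (lt_trans h4).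
have disj s e : Bf s e -> Af s e -> False by apply: sides_disjoint.
have cover s e : (first_cell s == e) || cell_lt (first_cell s) e ->
    (e == last_cell s) || cell_lt e (last_cell s) -> Bf s e || Af s e.
  by rewrite !cell_leE; apply: sides_cover.
have Bf_le s e : Bf s e -> (e == last_cell s) || cell_lt e (last_cell s).
  by rewrite cell_leE; apply: ideal_side_lex.
have Af_le s e : Af s e -> (first_cell s == e) || cell_lt (first_cell s) e.
  by rewrite cell_leE; apply: filter_side_lex.
have Bf_last s : Bf s (last_cell s) by apply: se_cell_ideal.
have Af_first s : Af s (first_cell s) by apply: nw_cell_filter.
have first_last s : cell_lt (first_cell s) (last_cell s).
  have [h _ _ _] := hd_last_extreme (last_mem s).
  by apply/orP; left; apply: lt_le_trans h; rewrite /= gtrBl.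
have sides_inc s a b : Bf s b -> Af s a -> cell_lt a b -> inc a b.
  by move=> h1 h2 h3; apply: lex_strictly_NW h3 (sides_separated h1 h2).
have Bf_ninc s e : Bf s e -> ~~ inc e (first_cell s).
  move/ideal_side_low => h; rewrite /inc /strictly_NW negb_and; apply/orP; right.
  by rewrite -leNgt ltW.
have Af_ninc s e : Af s e -> ~~ inc (last_cell s) e.
  move/filter_side_high => h; rewrite /inc /strictly_NW negb_and; apply/orP; right.
  by rewrite -leNgt; apply: le_trans h; rewrite /= gerBl.
have noncrossing s t a b : s \in F -> t \in F -> t != s -> cell_lt a b ->
    (first_cell s == a) || cell_lt (first_cell s) a ->
    (b == last_cell s) || cell_lt b (last_cell s) -> Af t a -> Bf t b ->
    Bf s a || (a == first_cell s) -> Af s b || (b == last_cell s) -> False.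
  rewrite !cell_leE => sF tF ts ab na bs ta tb sa sb.
  have := compatible_familyP _ _ Fc t s tF sF ts; apply/negP; rewrite negbK.
  apply: (crossing_clash ab na bs ta tb); rewrite -(inj_eq val_inj) in sa;
    by rewrite -(inj_eq val_inj) in sb.
have [bef [[tot anti tr dom] arcs adjacent]] := join_order
  (fun c => lex_lt_irr (val c)) (fun c d e => @lex_lt_trans (val c) (val d) (val e))
  cell_lt_total inc_tr disj cover Bf_le Af_le Bf_last Af_first first_last
  sides_inc Bf_ninc Af_ninc noncrossing.
have refl e : bef e e by have := tot e e; rewrite orbb.
(* Strict predecessors, because the labels are 0-based. *)
pose rk e := #|[set d | bef d e && (d != e)]|.
have rkN e : (rk e < #|` cells lam|)%N.
  rewrite -card_cells -cardsT; apply: proper_card; apply/properP; split; first exact: subsetT.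
  by exists e; rewrite // inE eqxx andbF.
have rk_lt d e : bef d e -> d != e -> (rk d < rk e)%N.
  move=> de nde; apply: proper_card; apply/properP; split.
    apply/subsetP=> c; rewrite !inE => /andP[cd ncd]; rewrite (tr _ _ _ cd de) /=.
    by apply: contraNneq ncd => ce; apply/eqP/anti => //; rewrite ce.
  by exists d; rewrite !inE ?de // eqxx andbF.
have rk_le d e : bef d e -> (rk d <= rk e)%N.
  by move=> de; have [->//|nde] := eqVneq d e; apply/ltnW/rk_lt.
have rk_bef d e : (rk d <= rk e)%N -> bef d e.
  move=> h; case/orP: (tot d e) => // ed; have [->//|nde] := eqVneq e d.
  by move: h; rewrite leqNgt rk_lt.
pose T : tableau := [ffun e => Ordinal (rkN e)].
have TE e : T e = rk e :> nat by rewrite ffunE.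
have Tinj : injective T.
  move=> d e /(congr1 val); rewrite /= !TE => de.
  by apply: anti; apply: rk_bef; rewrite de.
have TS : T \in SYT lam.
  rewrite inE; apply/andP; split; first exact/injectiveP.
  apply/forallP => d; apply/forallP => e; apply/implyP => de; rewrite !TE; apply: rk_le.
  have [->//|nde] := eqVneq d e; apply: dom.
    by case/orP: (cell_lt_total nde) => // ed; have /negP[] := cell_le_lex de.
  apply/negP => /andP[_ h]; case/andP: de => _; rewrite leNgt; exact/negP/negPn.
exists T => //.
have FT s : s \in F -> fits T s.
  move=> sF; have [fl adj low high] := arcs s sF; split.
  - rewrite !TE /rk (cardsD1 (last_cell s)) inE fl /=.
    have -> : last_cell s != first_cell s.
      by apply/eqP => e; apply: (disj s (first_cell s)) => //; rewrite -e.
    rewrite add1n; congr _.+1; congr #|pred_of_set _|; apply/setP=> e; rewrite !inE.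
    apply/and3P/andP => [[el ef efs]|[el nel]].
      split=> //; case/orP: (tot e (last_cell s)) => // le.
      by case: (adj e le ef) => e0; [rewrite e0 eqxx in el|rewrite e0 eqxx in efs].
    split=> //; first exact: tr el fl.
    apply: contraNneq nel => e0; apply/eqP/anti => //; rewrite e0 //.
  - by move=> e /low h; rewrite !TE; apply: rk_le.
  - by move=> e /high h; rewrite !TE; apply: rk_le.
apply/setP=> s; apply/idP/idP => [sD|sF]; last exact: fits_Des TS (FT s sF).
have fs := Des_fits TS sD; have [adj _ _] := fs.
have [||e d_e e_c|t tF [lt ft]] := adjacent (first_cell s) (last_cell s).
- by apply: rk_bef; rewrite -!TE adj.
- exact: first_last.
- have [->|n1] := eqVneq e (last_cell s); first by left.
  have [->|n2] := eqVneq e (first_cell s); first by right.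
  have := rk_lt _ _ e_c n2; have := rk_lt _ _ d_e; rewrite eq_sym => /(_ n1).
  by rewrite -!TE adj ltnS => h1 h2; have := leq_trans h1 h2; rewrite ltnn.
- by rewrite (fits_uniq fs (FT t tF) ft lt).
Qed.

Lemma SDes_eps T : SDes T = eps (Des T).
Proof.
apply/setP=> s; rewrite !in_set; congr [&& _, _ & _].
apply: eq_forallb => t; congr (_ ==> _).
by rewrite negb_and negbK orbC eq_sym implybE negbK.
Qed.

Lemma H'_poly_crossing :
  H'_poly lam = \sum_(F in compatible_family lam true) poly_x ^+ #|F| * poly_y ^+ #|eps F|.
Proof.
have <- : @Des lam @: SYT lam = compatible_family lam true.
  apply/setP=> F; apply/imsetP/idP => [[T TS ->]|/Des_surj[T TS <-]]; last by exists T.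
  exact: Des_compatible.
rewrite (big_imset _ Des_inj) /=; apply: eq_bigr => T _.
by rewrite /des /sdes SDes_eps.
Qed.

End Bijection.

Theorem theorem3p6 (lam : grid_shape) (hlam : reflected_skew_shape lam) :
  H_poly lam = H'_poly lam.
Proof.
have [corner chains] := hlam.
rewrite H_poly_crossing H'_poly_crossing //.
exact: has_cell_rectangle corner chains.
Qed.
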